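(* Let $k$ be a field of characteristic zero, let $d\in\mathbb N$, and let $N$ be a $d$-smallish $\mathrm{FS}_B^{\mathrm{op}}$-module over $k$. Then: (1) The generating function $H_B(N;t)=\sum_{n\ge 0} t^n\dim N[-n,n]$ is a rational function whose poles are contained in $\{1/j \mid 1\le j\le 2d+1\}$. (2) The limit $r_B^d(N):=\lim_{n\to\infty}\dim N[-n,n]/(2d+1)^n$ exists; equivalently, $H_B(N;t)$ has at worst a simple pole at $1/(2d+1)$, and $r_B^d(N)$ is the residue (in the sense of this limit). (3) If $\lambda,\mu$ are partitions with $|\lambda|+|\mu|=n$ and $\mathrm{Hom}_{W_n}(V_{\lambda,\mu},N[-n,n])\neq 0$, then $\ell(\lambda)\le d+1$ and $\ell(\mu)\le d$.
   Context: $\mathrm{FS}_B$ is the category whose objects are pairs $(E,\sigma)$ with $E$ a finite set and $\sigma:E\to E$ an involution with exactly one fixed point, and whose morphisms are surjective maps $\varphi$ with $\varphi\circ\sigma_1=\sigma_2\circ\varphi$. $[-n,n]$ denotes $\{-n,\dots,n\}$ with $k\mapsto -k$; every object is isomorphic to some $[-n,n]$, and $W_n=\mathrm{Aut}([-n,n])$ is the hyperoctahedral group (Coxeter group of type $B_n$, order $2^n n!$). An $\mathrm{FS}_B^{\mathrm{op}}$-module over $k$ is a contravariant functor from $\mathrm{FS}_B$ to $k$-vector spaces; $N[-n,n]:=N([-n,n])$, a $W_n$-representation. The principal projective $P_x$ sends $y$ to the $k$-vector space with basis $\mathrm{Hom}_{\mathrm{FS}_B}(y,x)$. A module is finitely generated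 in degree $\le d$ if it is a quotient of a finite direct sum of principal projectives $P_{[-m,m]}$ with $m\le d$ (i.e. generating objects having at most $d$ free $\sigma$-orbits). A module is $d$-small if it is isomorphic to a subquotient of a module finitely generated in degree $\le d$, and $d$-smallish if it admits a finite filtration whose associated graded module is $d$-small. For partitions $\lambda,\mu$ with $|\lambda|+|\mu|=n$, $V_{\lambda,\mu}$ is the irreducible $W_n$-representation over $k$ induced from $W_{|\lambda|}\times W_{|\mu|}$ by $(V_\lambda\otimes\text{(trivial character of }(\mathbb Z/2)^{|\lambda|}))\boxtimes (V_\mu\otimes\text{(sign character of }(\mathbb Z/2)^{|\mu|}))$, where $V_\lambda$ denotes the Specht module of $S_{|\lambda|}$; $\ell(\lambda)$ is the number of parts of $\lambda$. *)

(* Defs.v *)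
From HB Require Import structures.
From mathcomp Require Import all_boot all_order all_algebra all_fingroup.
From mathcomp Require Import all_classical all_reals all_analysis.

Set Implicit Arguments.
Unset Strict Implicit.
Unset Printing Implicit Defensive.

Import Order.TTheory GRing.Theory Num.Theory.
Local Open Scope ring_scope.

(* [-n,n] is modelled by 'I_(2n+1): the index i stands for i - n, so   *)
(* that the involution k |-> -k becomes rev_ord (i |-> 2n - i), whose  *)
(* unique fixed point is n (standing for 0).                           *)

Definition ptB (n : nat) := 'I_(n.*2.+1).

Definition isHomB (m n : nat) (f : {ffun ptB m -> ptB n}) : bool :=
  [forall y : ptB n, exists x : ptB m, f x == y] &&
  [forall x : ptB m, f (rev_ord x) == rev_ord (f x)].

Definition homB (m n : nat) := {f : {ffun ptB m -> ptB n} | isHomB f}.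

(* An FS_B^op-module over k, on the skeleton {[-n,n]}.  Each value is a
   finite-dimensional k-vector space (all d-smallish modules have this
   property). Contravariant: a morphism f : [-m,m] -> [-n,n] gives
   N(f) : N[-n,n] -> N[-m,m]. *)
Record FSBmod (k : fieldType) := FSBMod {
  fsb_obj :> nat -> vectType k;
  fsb_act : forall m n, homB m n -> fsb_obj n -> fsb_obj m;
  fsb_lin : forall m n (f : homB m n), linear (@fsb_act m n f);
  fsb_id : forall n (f : homB n n), (forall x, val f x = x) ->
     forall v, fsb_act f v = v;
  fsb_comp : forall l m n (f : homB l m) (g : homB m n) (h : homB l n),
     (forall x, val h x = val g (val f x)) ->
     forall v, fsb_act h v = fsb_act f (fsb_act g v)
}.
Arguments fsb_act {k} _ {m n} _ _.

Section Modules.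
Variable k : fieldType.

Definition dimB (N : FSBmod k) (n : nat) : nat := \dim (fullv : {vspace N n}).

(* M is finitely generated in degree <= d: M is a quotient of a finite
   direct sum of principal projectives P_[-m_i,m_i], m_i <= d.  By the
   Yoneda lemma a map P_[-m,m] -> M is an element x of M[-m,m] (image of
   id), sending the basis element f : [-n,n] -> [-m,m] to M(f) x; so the
   surjection is the statement that every element of every M[-n,n] is a
   k-linear combination of the M(f) x_i. *)
Definition fg_deg (M : FSBmod k) (d : nat) : Prop :=
  exists (r : nat) (m : 'I_r -> nat) (x : forall i, M (m i)),
    (forall i, (m i <= d)%N) /\
    forall (n : nat) (v : M n), exists c : forall i, {ffun homB n (m i) -> k},
      v = \sum_(i < r) \sum_(f : homB n (m i)) c i f *: fsb_act M f (x i).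

Definition is_submod (M : FSBmod k) (S : forall n, {vspace M n}) : Prop :=
  forall m n (f : homB m n) (v : M n), v \in S n -> fsb_act M f v \in S m.

(* N is d-small: N is isomorphic to B/A for submodules A <= B of a module M
   finitely generated in degree <= d.  The isomorphism B/A ~ N is given by
   a natural linear surjection p : B -> N with kernel A. *)
Definition dsmall (d : nat) (N : FSBmod k) : Prop :=
  exists (M : FSBmod k) (A B : forall n, {vspace M n})
         (p : forall n, M n -> N n),
    [/\ fg_deg M d, is_submod A, is_submod B,
        forall n, (A n <= B n)%VS &
        [/\ forall n, linear (p n),
            forall m n (f : homB m n) (v : M n), v \in B n ->
               p m (fsb_act M f v) = fsb_act N f (p n v),
            forall n (w : N n), exists2 v, v \in B n & p n v = w &
            forall n (v : M n), v \in B n -> (p n v = 0 <-> v \in A n)]].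

Definition is_filtration (N : FSBmod k) (r : nat)
    (F : nat -> forall n, {vspace N n}) : Prop :=
  [/\ forall n, F 0%N n = 0%VS, forall n, F r n = fullv,
      forall i n, (i < r)%N -> (F i n <= F i.+1 n)%VS &
      forall i, (i <= r)%N -> is_submod (F i)].

(* The associated graded gr N = (+)_{i=1..r} F_i/F_{i-1} is d-small: there
   are submodules A <= B of a module M finitely generated in degree <= d
   and a natural linear isomorphism B/A ~ gr N.  A linear map
   B -> F_i/F_{i-1} is encoded by a linear lift q i : M -> N landing in F_i
   on B, and is considered modulo F_{i-1}. *)
Definition gr_dsmall (d : nat) (N : FSBmod k) (r : nat)
    (F : nat -> forall n, {vspace N n}) : Prop :=
  exists (M : FSBmod k) (A B : forall n, {vspace M n})
         (q : nat -> forall n, M n -> N n),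
    [/\ fg_deg M d, is_submod A, is_submod B,
        forall n, (A n <= B n)%VS &
    [/\ forall i n, linear (q i n),
        forall i n (v : M n), (0 < i <= r)%N -> v \in B n -> q i n v \in F i n,
        forall i m n (f : homB m n) (v : M n), (0 < i <= r)%N -> v \in B n ->
           q i m (fsb_act M f v) - fsb_act N f (q i n v) \in F i.-1 m,
        forall n (w : 'I_r -> N n), (forall i : 'I_r, w i \in F i.+1 n) ->
           exists2 v, v \in B n &
             forall i : 'I_r, q i.+1 n v - w i \in F i n &
        forall n (v : M n), v \in B n ->
           (v \in A n <-> forall i, (0 < i <= r)%N -> q i n v \in F i.-1 n)]].

Definition dsmallish (d : nat) (N : FSBmod k) : Prop :=
  exists (r : nat) (F : nat -> forall n, {vspace N n}),
    @is_filtration N r F /\ @gr_dsmall d N r F.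

End Modules.

(* Group elements are mathcomp permutations of 'I_(2n+1); the mathcomp *)
(* product (s * t) is "s then t".  Since N is contravariant,           *)
(* g |-> N(g) is a left action of ({perm _}, * ); all representations  *)
(* below are left representations for this product (which differs from *)
(* the composition product by the anti-isomorphism g |-> g^-1; all     *)
(* characters involved are real, so nothing depends on this choice).   *)

Definition Wn (n : nat) : {set {perm ptB n}} :=
  [set s : {perm ptB n} | [forall x : ptB n, s (rev_ord x) == rev_ord (s x)]].

Definition is_partition (l : seq nat) : bool :=
  sorted geq l && all (fun x => 0 < x)%N l.

(* Young diagram of l, cells numbered 0..|l|-1 row by row *)
Definition row0 (l : seq nat) (p : nat) : nat :=
  find (fun r => p < sumn (take r.+1 l))%N (iota 0 (size l)).
Definition col0 (l : seq nat) (p : nat) : nat :=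
  (p - sumn (take (row0 l p) l))%N.

(* tabloids of shape l on the letters 'I_|l| : the row of each letter *)
Definition tabl (l : seq nat) := {ffun 'I_(sumn l) -> 'I_(sumn l).+1}.

(* a tableau T : {perm 'I_|l|} has entry T p in cell p.
   Column stabiliser C_T, and the tabloid {sigma T}. *)
Definition colStab (l : seq nat) (T s : {perm 'I_(sumn l)}) : bool :=
  [forall x, col0 l ((T^-1)%g (s x)) == col0 l ((T^-1)%g x)].
Definition tabloid_of (l : seq nat) (T s : {perm 'I_(sumn l)}) : tabl l :=
  [ffun x => inord (row0 l ((T^-1)%g ((s^-1)%g x)))].

Section Specht.
Variable k : fieldType.

(* the polytabloid e_T = sum_{s in C_T} sgn(s) {s T} in M^l = k^(tabloids);
   the Specht module V_l is the span of the polytabloids. *)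
Definition polytab (l : seq nat) (T : {perm 'I_(sumn l)}) (t : tabl l) : k :=
  \sum_(s | @colStab l T s) (-1) ^+ odd_perm s * (t == @tabloid_of l T s)%:R.

Variables (lam mu : seq nat).
Let a := sumn lam.
Let b := sumn mu.
Let n := (a + b)%N.

Definition absB (i : ptB n) : nat := if (n <= i)%N then (i - n)%N else (n - i)%N.
(* the point +(x+1) of [-n,n], x < a, and +(a+y+1), y < b *)
Definition posA (x : 'I_a) : ptB n := inord (n + x.+1).
Definition posB (y : 'I_b) : ptB n := inord (n + a + y.+1).

(* W_a x W_b inside W_n: the signed permutations preserving {+-1,..,+-a} *)
Definition Hsub : {set {perm ptB n}} :=
  [set h in Wn n | [forall x : 'I_a, (1 <= absB (h (posA x)) <= a)%N]].

Definition piA (h : {perm ptB n}) (x : 'I_a) : nat := (absB (h (posA x))).-1.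
Definition piB (h : {perm ptB n}) (y : 'I_b) : nat := (absB (h (posB y)) - a.+1)%N.
(* the sign character of (Z/2)^b, extended trivially to W_b *)
Definition sgnB (h : {perm ptB n}) : k :=
  (-1) ^+ #|[pred y : 'I_b | (h (posB y) < n)%N]|.

Definition tcomp (m : nat) (t : {ffun 'I_m -> 'I_m.+1}) (p : 'I_m -> nat) :
    {ffun 'I_m -> 'I_m.+1} :=
  [ffun x => if insub (p x) is Some y then t y else ord0].

Definition twist (h : {perm ptB n}) (p : tabl lam * tabl mu) : tabl lam * tabl mu :=
  (tcomp p.1 (piA (h^-1)%g), tcomp p.2 (piB (h^-1)%g)).

(* ambient space for the induced module, function model:
   Ind_H^G U = { f : G -> U | f(h g) = h . f(g) }, with U a subspace of
   k^(tabloids(lam) x tabloids(mu)) = M^lam (x) M^mu *)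
Definition AmbV := {ffun {perm ptB n} * (tabl lam * tabl mu) -> k^o}.

(* membership in V_{lam,mu} = Ind_{W_a x W_b}^{W_n}
      ((V_lam (x) triv) [x] (V_mu (x) sgn)) *)
Definition inV (f : AmbV) : Prop :=
  [/\ forall g p, g \notin Wn n -> f (g, p) = 0,
      forall h g p, h \in Hsub -> g \in Wn n ->
          f ((h * g)%g, p) = sgnB h * f (g, twist h p) &
      forall g, g \in Wn n ->
          exists c : {ffun {perm 'I_a} * {perm 'I_b} -> k},
            forall p, f (g, p) =
              \sum_(T : {perm 'I_a} * {perm 'I_b})
                 c T * (polytab T.1 p.1 * polytab T.2 p.2)].

Definition gactV (g' : {perm ptB n}) (f : AmbV) : AmbV :=
  [ffun q => f ((q.1 * g')%g, q.2)].

Definition HomV_nonzero (N : FSBmod k) : Prop :=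
  exists phi : AmbV -> N n,
    [/\ linear phi,
        exists2 f, inV f & phi f != 0 &
        forall f (g : {perm ptB n}) (hg : homB n n), inV f -> g \in Wn n ->
           (forall x, val hg x = g x) ->
           phi (gactV g f) = fsb_act N hg (phi f)].

End Specht.

(* Main.v *)
Require Import Defs.
From HB Require Import structures.
From mathcomp Require Import all_boot all_order all_algebra all_fingroup.
From mathcomp Require Import all_classical all_reals all_analysis.
From mathcomp Require Import ring lra zify.
Set Implicit Arguments.
Unset Strict Implicit.
Unset Printing Implicit Defensive.
Import Order.TTheory GRing.Theory Num.Theory.
Import numFieldNormedType.Exports.
Local Open Scope ring_scope.

(** For (1) and (2), write [gr N] as [B/A], for submodules [A <= B] of a quotient [M] of a sum of
    principal projectives. A morphism [[-n,n] -> [-m,m]] is the word of its values at [1..n] in the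
    alphabet [[-m,m]], and precomposition with a suitable surjection [[-n-1,n+1] -> [-n,n]]
    inserts a copy of a letter somewhere to its right. These insertions preserve the lexicographic
    order, so [dim B[-n,n] - dim A[-n,n]] is a difference of numbers of words of length [n] in sets
    closed under them (the leading words of the preimages of [B] and [A]).

    Let [S] be the set of letters already seen and [I] a set of words closed under inserting
    letters that are in [S] or occur earlier. Then [I] is the disjoint union of the [a (a\I)], where
    [a\I] is closed in the same sense for [S + a], and contains [I] if [a] is in [S]. The order
    generated by the insertions is a well-quasi-order (Nash-Williams), so induction on the
    complement of [S] and Noetherian induction on [I] apply to all [a\I] different from [I];
    the [j] remaining ones give [u (n+1) = j u n + g n] with [j <= 2d+1]. This recurrence yields both
    the denominator [1 - j t] and the convergence of [u n / (2d+1)^n].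

    For (3), a non-zero map from [V_(lam,mu)] does not vanish at some generator, whose image [x] is
    negated by the transpositions of the letters in the first column of the tableau of [lam]
    (of [mu]), and fixed (negated) by the sign changes of these letters. If the column is too long,
    then every morphism to [[-m,m]], [m <= d], is fixed by a signed permutation negating [x], and
    averaging over the stabiliser of the line of [x] gives [x = 0]. *)

(** * Words closed under insertion *)

Section Words.
Variable A : finType.
Implicit Types (S : {set A}) (I J : seq A -> Prop) (u v w : seq A).

Definition insertion_closed S I :=
  forall u v b, (b \in S) || (b \in u) -> I (u ++ v) -> I (u ++ b :: v).

(* The preorder generated by the allowed insertions, defined impredicatively. *)
Definition ins_le S w w' := forall I, insertion_closed S I -> I w -> I w'.

Lemma ins_le_trans S w2 w1 w3 : ins_le S w1 w2 -> ins_le S w2 w3 -> ins_le S w1 w3.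
Proof. by move=> h1 h2 I upI /(h1 I upI)/(h2 I upI). Qed.

Lemma insertion_closed_cons S I a :
  insertion_closed S I -> insertion_closed (a |: S) (fun w => I (a :: w)).
Proof.
move=> upI u v b hb Iw; apply: (upI (a :: u)) => //.
by move: hb; rewrite !inE -orbA => /or3P[->|->|->]; rewrite ?orbT.
Qed.

Lemma insertion_closed_consS S I a : a \in S ->
  insertion_closed S I -> insertion_closed S (fun w => I (a :: w)).
Proof.
by move=> aS /(@insertion_closed_cons _ _ a); rewrite (finset.setUidPr _) ?finset.sub1set.
Qed.

Lemma ins_le_cons S a w w' : ins_le (a |: S) w w' -> ins_le S (a :: w) (a :: w').
Proof. by move=> h I upI; apply: (h (fun w => I (a :: w))); exact: insertion_closed_cons. Qed.

Lemma ins_le_consl S a w : a \in S -> ins_le S w (a :: w).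
Proof. by move=> aS I upI Iw; apply: (upI [::]) => //; rewrite aS. Qed.

End Words.

(** * Minimal bad sequences and the well-quasi-order on words *)

Section MinimalBadSequence.
Variables (T : Type) (le : T -> T -> Prop) (sz : T -> nat).

Definition bad_seq (s : nat -> T) := forall i j, (i < j)%N -> ~ le (s i) (s j).
Definition agree_below n (s s' : nat -> T) := forall i, (i < n)%N -> s i = s' i.

Lemma minimal_bad_next n s : bad_seq s ->
  exists s', [/\ bad_seq s', agree_below n s' s &
    forall s'', bad_seq s'' -> agree_below n s'' s -> (sz (s' n) <= sz (s'' n))%N].
Proof.
move=> sbad.
pose P x := `[< exists s', [/\ bad_seq s', agree_below n s' s & sz (s' n) = x] >].
have exP : exists x, P x by exists (sz (s n)); apply/asboolP; exists s.
case: (ex_minnP exP) => x /asboolP [s' [b' a' sx]] xmin.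
exists s'; split=> // s'' b'' a''; rewrite sx; apply: xmin.
by apply/asboolP; exists s''.
Qed.

(** Nash-Williams' construction: step [n] minimises the size of term [n] while freezing the earlier
    terms. The diagonal of these sequences is bad, because any two of its terms already occur
    together in one bad sequence. *)
Lemma minimal_bad_seq s : bad_seq s ->
  exists2 m, bad_seq m & forall n s', bad_seq s' -> agree_below n s' m ->
    (sz (m n) <= sz (s' n))%N.
Proof.
move=> sbad.
pose B := {s | bad_seq s}.
have next (n : nat) (b : B) : {b' : B | agree_below n (sval b') (sval b) /\
    forall s'', bad_seq s'' -> agree_below n s'' (sval b) -> (sz (sval b' n) <= sz (s'' n))%N}.
  apply: cid; have [s' [b' a' m']] := minimal_bad_next n (svalP b).
  by exists (exist _ s' b').
pose S := fix S n : B := if n is n'.+1 then sval (next n' (S n')) else exist _ s sbad.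
have Sagree n k : agree_below n (sval (S (n + k)%N)) (sval (S n)).
  elim: k => [|k IH] i lin; first by rewrite addn0.
  rewrite addnS /= (proj1 (svalP (next (n + k)%N (S (n + k)%N)))) ?IH //.
  exact: leq_trans lin (leq_addr _ _).
have Sle n n' : (n <= n')%N -> agree_below n (sval (S n')) (sval (S n)).
  by move=> /subnKC <-; apply: Sagree.
exists (fun i => sval (S i.+1) i) => [i j ij|n s' bs' ag].
  rewrite -(Sle i.+1 j.+1) //; last by rewrite ltnS ltnW.
  exact: (svalP (S j.+1)).
apply: (proj2 (svalP (next n (S n)))) => // i lin.
by rewrite ag // (Sle i.+1 n).
Qed.

End MinimalBadSequence.

Lemma infinite_pigeonhole (A : finType) (c : nat -> A) :
  exists a (phi : nat -> nat), (forall i j, (i < j)%N -> (phi i < phi j)%N) /\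
    forall i, c (phi i) = a.
Proof.
have [a ha] : exists a, forall N, exists2 k, (N <= k)%N & c k = a.
  apply/not_existsP => h.
  have {}h a : {N | forall k, (N <= k)%N -> c k <> a}.
    apply: cid; have /existsNP [N hN] := h a; exists N => k Nk ck.
    by apply: hN; exists k.
  (* The maximum of all the bounds is beyond the last occurrence of every colour, including its
     own. *)
  have := svalP (h (c (\max_a sval (h a)))) (\max_a sval (h a)) (leq_bigmax _).
  exact.
have {}ha N : {k | (N <= k)%N & c k = a} by apply: cid2.
pose phi := fix phi i := if i is i'.+1 then s2val (ha (phi i').+1) else s2val (ha 0%N).
exists a, phi; split; last by case=> [|i] /=; [exact: (s2valP' (ha 0%N))|exact: (s2valP' (ha _))].
by apply: (homo_ltn ltn_trans) => k /=; exact: (s2valP (ha _)).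
Qed.

(** Induction on the number of letters outside [S]. A minimal bad sequence has a subsequence with
    constant first letter [a], and deleting [a] leaves a bad sequence for [a |: S]. If [a] is
    outside [S], this contradicts the induction hypothesis; otherwise it contradicts minimality. *)
Lemma ins_le_good (A : finType) (S : {set A}) (s : nat -> seq A) : ~ bad_seq (ins_le S) s.
Proof.
have [n] := ubnP #|~: S|; elim: n => // n IHn in S s *; rewrite ltnS => leSn.
move=> /(minimal_bad_seq size) [m mbad mmin].
(* The value [None] of [ohead] stands for the empty word; two empty words are comparable, which
   excludes it. *)
have [c [phi [phi_incr hc]]] := infinite_pigeonhole (fun i => ohead (m i)).
have phi_mono i j : (i <= j)%N -> (phi i <= phi j)%N.
  by rewrite leq_eqVlt => /predU1P[->//|/phi_incr/ltnW].
case: c hc => [a|] hc; last first.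
  apply: (mbad (phi 0%N) (phi 1%N)); first exact: phi_incr.
  by have := hc 0%N; have := hc 1%N; case: (m (phi 1%N)) => //; case: (m (phi 0%N)) => // _ _ I.
pose t i := behead (m (phi i)).
have mE i : m (phi i) = a :: t i.
  by have := hc i; rewrite /t; case: (m _) => //= ? ? [->].
have tbad S' : (S' = a |: S) -> bad_seq (ins_le S') t.
  move=> -> i j ij le_ij; apply: (mbad (phi i) (phi j)); first exact: phi_incr.
  by rewrite !mE; apply: ins_le_cons.
have [aS|aS] := boolP (a \in S); last first.
  apply: (IHn (a |: S) t); last exact: tbad.
  apply: leq_trans leSn; apply: proper_card.
  by rewrite finset.setCU finset.setIC; apply/properP; split; [exact: finset.subsetIl|exists a; rewrite !inE ?aS ?eqxx].
have {}tbad := tbad S (esym (finset.setUidPr _)).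
(* Deleting the common first letter [a] gives a bad sequence below the minimal one. *)
pose s' i := if (i < phi 0)%N then m i else t (i - phi 0)%N.
have s'bad : bad_seq (ins_le S) s'.
  move=> i j ij; rewrite /s'; case: (ltnP j (phi 0%N)) => hj.
    by rewrite (ltn_trans ij hj); apply: mbad.
  case: (ltnP i (phi 0%N)) => hi; last first.
    by apply: tbad; rewrite ?finset.sub1set // ltn_sub2r // (leq_ltn_trans hi).
  (* Prepending [a], which is in [S], is an allowed insertion and recovers a term of [m], at an
     index still beyond [i]. *)
  move=> le_ij; apply: (mbad i (phi (j - phi 0)%N)).
    by rewrite (leq_trans hi) // phi_mono.
  apply: (ins_le_trans le_ij); rewrite mE; exact: ins_le_consl.
have := mmin (phi 0%N) s' s'bad; rewrite mE /s' ltnn subnn /= ltnn => H.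
by apply: notF; apply: H => i ->.
Qed.

(** A counterexample yields a strictly increasing chain [T] of closed sets. Choose [s n] in [T n.+1]
    but not in [T n]: for [i < j], [T j] is closed and contains [s i] but not [s j], so [s] is a bad
    sequence. *)
Lemma insertion_closed_ind (A : finType) (S : {set A}) (P : (seq A -> Prop) -> Prop) :
  (forall I, insertion_closed S I ->
     (forall I', insertion_closed S I' -> (forall w, I w -> I' w) ->
        (exists2 w, I' w & ~ I w) -> P I') -> P I) ->
  forall I, insertion_closed S I -> P I.
Proof.
move=> IH I0 I0c; apply: contrapT => nPI0.
pose B := {I : seq A -> Prop | insertion_closed S I /\ ~ P I}.
have next (b : B) : {b' : B * seq A | (forall w, sval b w -> sval b'.1 w) /\
                                      (sval b'.1 b'.2 /\ ~ sval b b'.2)}.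
  apply: cid; case: b => I [Ic nPI] /=; apply: contrapT => hno.
  apply: nPI; apply: IH => // I' I'c II' [w I'w nIw].
  apply: contrapT => nPI'; apply: hno.
  by exists (exist _ I' (conj I'c nPI'), w).
pose T := fix T n : B := if n is n'.+1 then (sval (next (T n'))).1
                         else exist _ I0 (conj I0c nPI0).
pose s n := (sval (next (T n))).2.
have Tmono i j w : (i <= j)%N -> sval (T i) w -> sval (T j) w.
  move=> /subnKC <-; elim: (j - i)%N => [|k IHk]; rewrite ?addn0 ?addnS //.
  by move=> /IHk; exact: (proj1 (svalP (next (T (i + k)%N)))).
apply: (@ins_le_good _ S s) => i j ij le_ij.
have [_ [_ nTj]] := svalP (next (T j)); apply: nTj.
apply: (le_ij _ (proj1 (svalP (T j)))); apply: (Tmono i.+1) => //.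
by have [_ []] := svalP (next (T i)).
Qed.

(** Recursion on the first letter makes the linear recurrence definitional; [word_countE] recovers
    the cardinality. *)
Fixpoint word_count (A : finType) (I : seq A -> Prop) n : nat :=
  if n is n'.+1 then (\sum_(a : A) word_count (fun w => I (a :: w)) n')%N
  else `[< I [::] >].

Lemma word_countE (A : finType) (I : seq A -> Prop) n :
  word_count I n = #|[set t : n.-tuple A | `[< I t >]]|.
Proof.
elim: n I => [|n IHn] I /=.
  have -> : [set t : 0.-tuple A | `[< I t >]] = if `[< I [::] >] then [set: 0.-tuple A] else finset.set0.
    by apply/setP => t; rewrite finset.inE tuple0; case: asboolP => h; rewrite finset.inE.
  by case: ifP; rewrite ?cards0 // cardsT card_tuple expn0.
rewrite (eq_bigr _ (fun a _ => IHn _)).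
pose X := [set t : n.+1.-tuple A | `[< I t >]].
rewrite -[RHS]sum1_card (partition_big (fun t : n.+1.-tuple A => thead t) predT) //=.
apply: eq_bigr => a _; rewrite -sum1_card.
rewrite (reindex_onto (fun t : n.-tuple A => [tuple of a :: t]) (fun t : n.+1.-tuple A => [tuple of behead t] : n.-tuple A)) /=.
  apply: eq_bigl => t; rewrite !finset.inE theadE eqxx andbT.
  have -> : [tuple of behead [tuple of a :: t]] = t :> n.-tuple A by apply: val_inj.
  by rewrite eqxx andbT.
move=> t /andP[_ /eqP <-]; exact/esym/tuple_eta.
Qed.

Lemma word_countS (A : finType) (I : seq A -> Prop) n :
  word_count I n.+1 = (\sum_(a : A) word_count (fun w => I (a :: w)) n)%N.
Proof. by []. Qed.

(** * Rational generating functions *)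

Section RationalSeries.
Implicit Types (p q P : {poly rat}) (u v : nat -> rat) (e : nat -> nat).

(** The coefficient of [t^n] in the product of [p] with the power series of coefficients [u]. *)
Definition conv p u n := \sum_(i < n.+1) p`_i * u (n - i)%N.

(** Coefficients up to [N] only see the truncated series, so the laws of polynomial multiplication
    carry over to [conv]. *)
Lemma conv_trunc p u n N : (n <= N)%N -> conv p u n = (p * \poly_(i < N.+1) u i)`_n.
Proof.
move=> nN; rewrite coefM; apply: eq_bigr => i _; rewrite coef_poly ltnS.
by rewrite (leq_trans (leq_subr _ _) nN).
Qed.

Lemma convM p q u n : conv (p * q) u n = conv p (conv q u) n.
Proof.
rewrite (conv_trunc _ _ (leqnn n)) -mulrA coefM; apply: eq_bigr => i _.
by rewrite (@conv_trunc q u (n - i) n) ?leq_subr.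
Qed.

Lemma conv_coef p P n : conv p (fun i => P`_i) n = (p * P)`_n.
Proof. by rewrite coefM. Qed.

Lemma eq_conv p u v n : u =1 v -> conv p u n = conv p v n.
Proof. by move=> uv; apply: eq_bigr => i _; rewrite uv. Qed.

Definition den D e : {poly rat} := \prod_(1 <= j < D.+1) (1 - j%:R *: 'X) ^+ e j.

Definition rational_series D u := exists P e, forall n, conv (den D e) u n = P`_n.

Lemma den_add D e e' : den D (fun j => e j + e' j)%N = den D e * den D e'.
Proof. by rewrite /den -big_split /=; under eq_bigr do rewrite exprD. Qed.

Lemma rational_series_ext D u v : u =1 v -> rational_series D u -> rational_series D v.
Proof. by move=> uv [P [e h]]; exists P, e => n; rewrite -h; apply: eq_conv => i. Qed.

Lemma rational_seriesD D u v : rational_series D u -> rational_series D v ->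
  rational_series D (fun n => u n + v n).
Proof.
move=> [P [e hu]] [Q [f hv]].
exists (den D f * P + den D e * Q), (fun j => e j + f j)%N => n.
have -> : conv (den D (fun j => e j + f j)%N) (fun n => u n + v n) n =
    conv (den D f * den D e) u n + conv (den D e * den D f) v n.
  rewrite den_add [den D f * _]mulrC /conv -[RHS]big_split /=.
  by apply: eq_bigr => i _; rewrite mulrDr.
by rewrite !convM coefD -!conv_coef; congr (_ + _); apply: eq_conv.
Qed.

Lemma rational_seriesN D u : rational_series D u -> rational_series D (fun n => - u n).
Proof.
move=> [P [e hu]]; exists (- P), e => n; rewrite coefN -hu /conv -sumrN /=.
by apply: eq_bigr => i _; rewrite mulrN.
Qed.

Lemma rational_series0 D : rational_series D (fun => 0).
Proof.
by exists 0, (fun => 0%N) => n; rewrite coef0 /conv big1 // => i _; rewrite mulr0.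
Qed.

Lemma rational_series_sum D (T : finType) (Q : pred T) (u : T -> nat -> rat) :
  (forall t, Q t -> rational_series D (u t)) ->
  rational_series D (fun n => \sum_(t | Q t) u t n).
Proof.
move=> h.
suff : rational_series D (\sum_(t | Q t) (u t : nat -> rat)).
  by apply: rational_series_ext => n; rewrite fct_sumE.
apply: (big_ind (rational_series D)) => //; first exact: rational_series0.
by move=> x y; exact: rational_seriesD.
Qed.

(** With generating functions [U] and [G], the recurrence reads [(1 - j t) U = u 0 + t G]. *)
Lemma rational_series_rec D j u g : (j <= D)%N ->
  (forall n, u n.+1 = j%:R * u n + g n) ->
  rational_series D g -> rational_series D u.
Proof.
move=> jD rec [P [e hg]].
pose f i := ((i == j) : nat).
have fE : den D f = 1 - j%:R *: 'X.
  (* For [j = 0] no factor of the product is selected, in agreement with [1 - 0 t = 1]. *)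
  rewrite /den; case: j jD @f {rec} => [|j] jD f.
    rewrite scale0r subr0 big_nat_cond big1 // => i /andP[/andP[i0 _] _].
    by rewrite /f eqn0Ngt i0 expr0.
  rewrite (bigD1_seq j.+1) ?iota_uniq ?mem_index_iota //= big1.
    by rewrite mulr1 /f eqxx expr1.
  by move=> i /negPf ij; rewrite /f ij expr0.
(* The numerator is [u 0 + t G] multiplied by [den D e], where [den D e] times [G] is [P]. *)
exists ((u 0%N) *: den D e + 'X * P), (fun j => e j + f j)%N => n.
rewrite den_add convM.
rewrite (@eq_conv _ _ (fun n => (u 0%N) * (n == 0%N)%:R + (if n is n'.+1 then g n' else 0))); last first.
  move=> i; rewrite fE /conv big_ord_recl subn0 coefB coef1 coefZ coefX mulr0 subr0 mul1r.
  case: i => [|i]; first by rewrite big_ord0 mulr1.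
  rewrite big_ord_recl big1 ?addr0; last first.
    by move=> l _; rewrite coefB coef1 coefZ coefX /= mulr0 subr0 mul0r.
  rewrite /= /bump /= coefB coef1 coefZ coefX /= subn1 /= rec mulr1 mulr0 !add0r.
  by rewrite mulNr addrAC subrr add0r.
rewrite coefD coefZ coefXM /conv.
under eq_bigr do rewrite mulrDr.
rewrite big_split /=; congr (_ + _).
  rewrite big_ord_recr /= subnn mulr1 big1 ?add0r 1?mulrC // => i _.
  by rewrite subn_eq0 leqNgt ltn_ord !mulr0.
rewrite big_ord_recr /= subnn mulr0 addr0; case: n => [|n]; first by rewrite big_ord0.
rewrite /= -hg; apply: eq_bigr => i _.
by rewrite (subSn (ltnSE (ltn_ord i))).
Qed.

End RationalSeries.

(** * Convergence after division by a geometric sequence *)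

Section Limits.
Variable R : realType.
Local Open Scope classical_set_scope.

(** The limit [L] solves [L = rho L + y], and the distance to [L] is contracted by [rho] up to an
    error [|g n - y|] that tends to 0. *)
Lemma cvgn_affine_rec (rho y : R) (x g : nat -> R) : 0 <= rho < 1 ->
  (forall n, x n.+1 = rho * x n + g n) -> g @ \oo --> y ->
  x @ \oo --> y / (1 - rho).
Proof.
move=> /andP[rho0 rho1] rec gy.
have r1 : 0 < 1 - rho by rewrite subr_gt0.
set L := y / (1 - rho).
have LE : L = rho * L + y by rewrite /L; field; rewrite gt_eqF.
have step n : `|x n.+1 - L| <= rho * `|x n - L| + `|g n - y|.
  rewrite (_ : x n.+1 - L = rho * (x n - L) + (g n - y)); last first.
    by rewrite rec {1}LE; ring.
  by rewrite (le_trans (ler_normD _ _)) // normrM (ger0_norm rho0).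
apply/cvgrPdist_lt => eps eps0.
(* This tolerance keeps the bound [eps / 2] stable: [rho * (eps / 2) + (eps / 2) * (1 - rho) = eps /
   2]. *)
have e2 : 0 < eps / 2 * (1 - rho) by rewrite mulr_gt0 // divr_gt0.
have /cvgrPdist_lt/(_ _ e2)[N _ hN] := gy.
have bound k : `|x (N + k)%N - L| <= rho ^+ k * `|x N - L| + eps / 2.
  elim: k => [|k IH]; first by rewrite addn0 expr0 mul1r ler_wpDr // ltW // divr_gt0.
  rewrite addnS (le_trans (step _)) //.
  have gk : `|g (N + k)%N - y| <= eps / 2 * (1 - rho).
    by rewrite distrC ltW //; apply: hN; rewrite /= leq_addr.
  have := ler_wpM2l rho0 IH; rewrite exprS; lra.
have rhoc : (fun k => rho ^+ k * `|x N - L|) @ \oo --> (0 : R).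
  rewrite -(mul0r `|x N - L|); apply: cvgMl; apply: cvg_expr.
  by rewrite ger0_norm.
have eps2 : 0 < eps / 2 by rewrite divr_gt0.
have /cvgrPdist_lt/(_ _ eps2)[K _ hK] := rhoc.
exists (N + K)%N => // n /= NKn.
have Nn : (N <= n)%N by apply: leq_trans NKn; exact: leq_addr.
have := bound (n - N)%N; rewrite subnKC // => h.
have := hK (n - N)%N; rewrite /= leq_subRL // => /(_ NKn).
rewrite sub0r normrN => /ltr_normlW h2.
rewrite distrC; lra.
Qed.

Definition growth_cvg (J : nat) (u : nat -> R) :=
  exists l : R, (fun n => u n / (J ^ n)%:R) @ \oo --> l.

Lemma growth_cvgD J u v : growth_cvg J u -> growth_cvg J v ->
  growth_cvg J (fun n => u n + v n).
Proof.
move=> [l hl] [l' hl']; exists (l + l').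
rewrite (_ : (fun n => _) = (fun n => u n / (J ^ n)%:R + v n / (J ^ n)%:R)); last first.
  by apply: funext => n; rewrite mulrDl.
exact: cvgD.
Qed.

Lemma growth_cvgN J u : growth_cvg J u -> growth_cvg J (fun n => - u n).
Proof.
move=> [l hl]; exists (- l).
rewrite (_ : (fun n => _) = (fun n => - (u n / (J ^ n)%:R))); last first.
  by apply: funext => n; rewrite mulNr.
exact: cvgN.
Qed.

Lemma growth_cvg_sum J (T : finType) (Q : pred T) (u : T -> nat -> R) :
  (forall t, Q t -> growth_cvg J (u t)) -> growth_cvg J (fun n => \sum_(t | Q t) u t n).
Proof.
move=> h.
rewrite (_ : (fun n => _) = \sum_(t | Q t) (u t : nat -> R)); last first.
  by apply: funext => n; rewrite fct_sumE.
apply: (big_ind (growth_cvg J)) => //; last by move=> x y; exact: growth_cvgD.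
by exists 0; under eq_fun do rewrite mul0r; exact: cvg_cst.
Qed.

(** Dividing the recurrence by [J ^ n.+1] gives an affine recurrence of ratio [j / J], which is less
    than 1. *)
Lemma growth_cvg_rec J j (u g : nat -> R) : (j < J)%N ->
  (forall n, u n.+1 = j%:R * u n + g n) -> growth_cvg J g -> growth_cvg J u.
Proof.
move=> jJ rec [l hl].
have J0 : (0 < J)%N by apply: leq_ltn_trans jJ.
have JR : (J%:R : R) != 0 by rewrite pnatr_eq0 -lt0n.
exists (l / J%:R / (1 - j%:R / J%:R)).
apply: (@cvgn_affine_rec _ _ _ (fun n => g n / (J ^ n)%:R / J%:R)).
- by rewrite divr_ge0 ?ler0n //= ltr_pdivrMr ?ltr0n // mul1r ltr_nat.
- move=> n; rewrite rec expnS natrM; field.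
  by rewrite JR pnatr_eq0 expn_eq0 negb_and -lt0n J0.
- by apply: cvgMl.
Qed.

End Limits.

(** * Growth of the counting function of a closed set of words *)

Lemma word_count_tame (R : realType) (A : finType) (J : nat) (S : {set A})
    (I : seq A -> Prop) : (0 < J)%N -> (#|A| <= J)%N -> insertion_closed S I ->
  rational_series J (fun n => (word_count I n)%:R) /\
  growth_cvg J (fun n => (word_count I n)%:R : R).
Proof.
move=> J0 AJ; have [n] := ubnP #|~: S|; elim: n => // n IHn in S I *; rewrite ltnS => leSn.
move: I; apply: insertion_closed_ind => I Ic IHI.
(* The letters of [E] produce the denominator [1 - #|E| t]; all others fall under an induction. *)
pose E := [set a in S | `[< (fun w => I (a :: w)) = I >]].
have rec m : word_count I m.+1 =
    (#|E| * word_count I m + \sum_(a | a \notin E) word_count (fun w => I (a :: w)) m)%N.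
  rewrite word_countS (bigID (mem E)) /=; congr (_ + _)%N.
  by rewrite -sum_nat_const; apply: eq_bigr => a; rewrite finset.inE => /andP[_ /asboolP ->].
(* A letter outside [S] enlarges [S]; a letter of [S] that is not in [E] gives a strictly larger
   closed set for the same [S]. *)
have tame a : a \notin E ->
    rational_series J (fun n => (word_count (fun w => I (a :: w)) n)%:R) /\
    growth_cvg J (fun n => (word_count (fun w => I (a :: w)) n)%:R : R).
  rewrite finset.inE negb_and; case: (boolP (a \in S)) => aS /=; last first.
    move=> _; apply: (IHn (a |: S)); last exact: insertion_closed_cons.
    apply: leq_trans leSn; apply: proper_card; rewrite finset.setCU finset.setIC.
    by apply/properP; split; [exact: finset.subsetIl|exists a; rewrite !finset.inE ?aS ?eqxx].
  move=> /asboolP neqI; apply: IHI.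
  - exact: insertion_closed_consS.
  - by move=> w Iw; apply: (Ic [::]) => //; rewrite aS.
  - apply: contrapT => h; apply: neqI; apply: funext => w; apply: propext; split.
      by move=> Iaw; apply: contrapT => nIw; apply: h; exists w.
    by move=> Iw; apply: (Ic [::]) => //; rewrite aS.
have recR (F : pzRingType) m : (word_count I m.+1)%:R =
    #|E|%:R * (word_count I m)%:R +
    \sum_(a | a \notin E) (word_count (fun w => I (a :: w)) m)%:R :> F.
  by rewrite rec natrD natrM natr_sum.
have EJ : (#|E| <= J)%N by apply: leq_trans AJ; exact: max_card.
split.
  apply: (rational_series_rec EJ (recR _)).
  by apply: rational_series_sum => a /tame[].
move: EJ; rewrite leq_eqVlt => /predU1P[EJ|EJ]; last first.
  by apply: (growth_cvg_rec EJ (recR _)); apply: growth_cvg_sum => a /tame[].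
(* In the critical case [#|E| = J] the ratio is 1, but then every letter is in [E]: the
   inhomogeneous term is empty and the growth exactly geometric. *)
have uJ m : word_count I m = (J ^ m * word_count I 0)%N.
  elim: m => [|m IHm]; first by rewrite mul1n.
  rewrite rec IHm EJ expnS mulnA big1 ?addn0 // => a.
  have /eqP -> : E == [set: A] by rewrite eqEcard finset.subsetT cardsT EJ.
  by rewrite finset.in_setT.
exists (word_count I 0)%:R.
rewrite (_ : (fun n => _) = fun=> (word_count I 0)%:R); first exact: cvg_cst.
apply: funext => m; rewrite uJ natrM mulrAC divff ?mul1r //.
by rewrite pnatr_eq0 expn_eq0 negb_and -lt0n J0.
Qed.

(** * Leading terms and filtrations *)

(** Linearity is only a proposition in the module records; bundling the map gives access to kernels,
    images and ranks. *)
Lemma exists_lfun (k : fieldType) (U V : vectType k) (f : U -> V) :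
  linear f -> {F : 'Hom(U, V) | forall u, F u = f u}.
Proof.
move=> lf.
pose f' : {linear U -> V} := HB.pack f (GRing.isLinear.Build _ _ _ _ f lf).
by exists (linfun f') => u; rewrite lfunE.
Qed.

Section LeadingTerms.
Variables (k : fieldType) (T : finType) (disp : Order.disp_t) (O : orderType disp).
Variable key : T -> O.
Hypothesis key_inj : injective key.
Implicit Types V : {vspace {ffun T -> k^o}}.

Definition leading V t :=
  exists2 v, v \in V & v t != 0 /\ forall t', (key t < key t')%O -> v t' = 0.

(** Echelon form, by induction on a set [D] containing all supports. Evaluation at the element [t]
    of [D] with the largest key has a kernel whose leading indices are those of [V] other than [t];
    its image has dimension one or zero according to whether [t] is leading. *)
Lemma dim_leading V : \dim V = #|[set t | `[< leading V t >]]|.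
Proof.
suff H n : forall (D : {set T}) V, (#|D| < n)%N ->
    (forall v t, v \in V -> t \notin D -> v t = 0) ->
    \dim V = #|[set t | `[< leading V t >]]|.
  by apply: (H #|[set: T]|.+1 [set: T]) => // v t _; rewrite finset.in_setT.
elim: n => // n IHn D {}V; rewrite ltnS => leDn suppV.
have [D0|[t0 t0D]] := set_0Vmem D.
  have V0 v t : v \in V -> v t = 0 by move=> vV; apply: suppV => //; rewrite D0 finset.inE.
  have -> : V = 0%VS.
    apply/eqP; rewrite -subv0; apply/subvP => v vV; rewrite memv0.
    by apply/eqP/ffunP => t; rewrite ffunE V0.
  rewrite dimv0; apply/esym/eqP; rewrite cards_eq0; apply/eqP/setP => t.
  rewrite finset.inE finset.in_set0; apply/asboolP => -[v].
  by rewrite memv0 => /eqP -> [/eqP[]]; rewrite ffunE.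
case: (Order.TotalTheory.arg_maxP key t0D) => t tD tmax {t0 t0D}.
have {}tD : t \in D by [].
have [ev evE] : {ev : 'Hom({ffun T -> k^o}, k^o) | forall v, ev v = v t}.
  by apply: exists_lfun => a u v; rewrite !ffunE.
have kerE v : (v \in (V :&: lker ev)%VS) = (v \in V) && (v t == 0).
  by rewrite memv_cap memv_ker evE.
have gt_t v t' : v \in V -> (key t < key t')%O -> v t' = 0.
  move=> vV tt'; apply: suppV => //; apply/negP => t'D.
  by have /= := tmax t' t'D; rewrite leNgt tt'.
rewrite -(limg_ker_dim ev V) (IHn (D :\ t)); first last.
- move=> v t'; rewrite kerE => /andP[vV /eqP vt]; rewrite !finset.inE negb_and negbK.
  by case/predU1P => [->|] //; exact: suppV.
- by apply: leq_trans leDn; rewrite (cardsD1 t D) tD.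
have leadE t' : `[< leading (V :&: lker ev)%VS t' >] = (t' != t) && `[< leading V t' >].
  apply/asboolP/andP => [[v]|[t't /asboolP[v vV [vt' vgt]]]].
    rewrite kerE => /andP[vV /eqP vt] [vt' vgt]; split.
      by apply: contra_neq vt' => ->.
    by apply/asboolP; exists v.
  exists v => //; rewrite kerE vV vgt //= lt_neqAle.
  rewrite (inj_eq key_inj) t't; apply: tmax; apply: contraNT vt' => t'D.
  by rewrite suppV.
rewrite [RHS](cardsD1 t) addnC; congr (_ + _)%N; last first.
  by apply: eq_card => t'; rewrite !finset.inE leadE.
rewrite finset.inE; apply/eqP; rewrite eqn_leq; apply/andP; split.
  case: asboolP => [_|nlead].
    by apply: leq_trans (dimvS (subvf _)) _; rewrite dimvf /= /dim /=.
  rewrite leqn0 dimv_eq0 -subv0; apply/subvP => _ /memv_imgP[v vV ->]; rewrite memv0 evE.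
  apply/negPn/negP => vt; apply: nlead; exists v => //; split => // t'.
  exact: gt_t.
case: asboolP => [[v vV [vt _]]|//]; rewrite lt0n dimv_eq0; apply: contraNneq vt => ev0.
by rewrite -memv0 -ev0 -evE memv_img.
Qed.

End LeadingTerms.

(** At a single object, [B/A] is isomorphic to the associated graded space of [W], which has the
    dimension of [W]. The count is rank-nullity for a map from [B] onto [W] with kernel [A]. *)
Lemma filtered_dim (k : fieldType) (V W : vectType k) (A B : {vspace V}) (r : nat)
    (F : nat -> {vspace W}) (q : nat -> V -> W) :
  (A <= B)%VS -> F 0%N = 0%VS -> F r = fullv ->
  (forall i, (i < r)%N -> (F i <= F i.+1)%VS) ->
  (forall i, linear (q i)) ->
  (forall i v, (0 < i <= r)%N -> v \in B -> q i v \in F i) ->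
  (forall w : 'I_r -> W, (forall i : 'I_r, w i \in F i.+1) ->
     exists2 v, v \in B & forall i : 'I_r, q i.+1 v - w i \in F i) ->
  (forall v, v \in B -> (v \in A <-> forall i, (0 < i <= r)%N -> q i v \in F i.-1)) ->
  (\dim {:W} + \dim A)%N = \dim B.
Proof.
(* Projecting [q i.+1] onto a complement [C i] of [F i] in [F i.+1] gives a single linear map. *)
move=> AB F0 Fr Fmono qlin qF qsurj qA.
pose C i := (F i.+1 :\: F i)%VS.
have CF i : (C i :&: F i = 0)%VS by exact: capv_diff.
have CFD i : (i < r)%N -> (C i + F i = F i.+1)%VS.
  by move=> ir; rewrite addv_diff; apply/addv_idPl/Fmono.
have CS i : (C i <= F i.+1)%VS by exact: diffvSl.
have Fle i j : (i <= j <= r)%N -> (F i <= F j)%VS.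
  move=> /andP[/subnKC <-]; elim: (j - i)%N => [|l IH]; rewrite ?addn0 ?subvv // addnS => ilr.
  by apply: subv_trans (IH _) (Fmono _ _); rewrite // ltnW.
(* On [F i.+1], [p i] is the projection onto [C i] with kernel [F i]. *)
pose p i := daddv_pi (C i) (F i).
have pC i x : x \in C i -> p i x = x by exact: daddv_pi_id.
have pF0 i x : (i < r)%N -> x \in F i -> p i x = 0.
  move=> ir xF; apply/eqP; rewrite -memv0 -(CF i) memv_cap memv_pi /=.
  have xE : p i x + daddv_pi (F i) (C i) x = x.
    by apply: daddv_pi_add => //; rewrite CFD // (subvP (Fmono i ir)).
  by rewrite -(addrK (daddv_pi (F i) (C i) x) (p i x)) xE rpredB ?memv_pi.
have p0F i x : (i < r)%N -> x \in F i.+1 -> p i x = 0 -> x \in F i.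
  move=> ir xF px0; have := @daddv_pi_add _ _ (C i) (F i) x (CF i).
  by rewrite CFD // => /(_ xF); rewrite -/(p i) px0 add0r => <-; exact: memv_pi.
have Csum j (c : nat -> W) : (j <= r)%N -> (forall i, (i < j)%N -> c i \in C i) ->
    \sum_(i < j) c i \in F j.
  move=> jr hc; apply: rpred_sum => i _; apply: (subvP (Fle i.+1 j _)); rewrite ?ltn_ord //.
  exact: (subvP (CS i)) _ (hc _ _).
(* The sum of the [C i] is direct: applying the top projection kills all lower terms. *)
have Csum0 j (c : nat -> W) : (j <= r)%N -> (forall i, (i < j)%N -> c i \in C i) ->
    \sum_(i < j) c i = 0 -> forall i, (i < j)%N -> c i = 0.
  elim: j => // j IHj jr hc; rewrite big_ord_recr /= => sum0.
  have hc' i : (i < j)%N -> c i \in C i by move=> ij; apply: hc; rewrite ltnW.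
  have cj0 : c j = 0.
    rewrite -(pC j (c j)) ?hc //; apply: pF0 => //.
    rewrite -[c j](addKr (\sum_(i < j) c i)) sum0 addr0 rpredN.
    exact: Csum (ltnW jr) hc'.
  move=> i; rewrite ltnS leq_eqVlt => /predU1P[->//|ij].
  by apply: (IHj (ltnW jr)) => //; move: sum0; rewrite cj0 addr0.
have Cdec j w : (j <= r)%N -> w \in F j ->
    exists2 c : nat -> W, (forall i, (i < j)%N -> c i \in C i) & w = \sum_(i < j) c i.
  elim: j w => [|j IHj] w jr wF.
    by exists (fun=> 0) => //; rewrite big_ord0; apply/eqP; rewrite -memv0 -F0.
  have [] := IHj (w - p j w) (ltnW jr).
    apply: p0F => //; last by rewrite linearB /= (pC j (p j w)) ?subrr ?memv_pi.
    by rewrite rpredB // (subvP (CS j)) // memv_pi.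
  move=> c hc wE; exists (fun i => if i == j then p j w else c i) => [i|].
    by rewrite ltnS leq_eqVlt; case: eqP => [-> _|_ /= /hc//]; rewrite memv_pi.
  rewrite big_ord_recr /= eqxx -[LHS](subrK (p j w)) wE; congr (_ + _).
  by apply: eq_bigr => i _; rewrite ltn_eqF.
have [P PE] : {P : 'Hom(V, W) | forall v, P v = \sum_(i < r) p i (q i.+1 v)}.
  apply: exists_lfun => a u v; rewrite scaler_sumr -big_split /=.
  by apply: eq_bigr => i _; rewrite qlin linearP.
have <- : (B :&: lker P)%VS = A.
  apply/eqP; rewrite eqEsubv; apply/andP; split; apply/subvP => v.
    rewrite memv_cap memv_ker PE => /andP[vB /eqP P0]; apply/(qA _ vB) => i /andP[i0 ir].
    have pv0 := Csum0 r (fun i => p i (q i.+1 v)) (leqnn r) (fun i _ => memv_pi _ _ _) P0 i.-1.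
    apply: p0F; rewrite ?prednK //; first by apply: qF; rewrite ?i0.
    by rewrite -{2}(prednK i0); apply: pv0; rewrite prednK.
  move=> vA; have vB := subvP AB _ vA; rewrite memv_cap vB memv_ker PE /=.
  by apply/eqP/big1 => i _; apply: pF0 => //; apply: ((qA _ vB).1 vA i.+1 (ltn_ord i)).
rewrite -(limg_ker_dim P B) addnC; congr (_ + \dim _)%N.
apply/eqP; rewrite eqEsubv subvf andbT; apply/subvP => w _.
have [|c hc ->] := Cdec r w (leqnn r); first by rewrite Fr memvf.
have [i|v vB hv] := qsurj (fun i => c i); first by rewrite (subvP (CS i)) ?hc.
apply/memv_imgP; exists v; rewrite ?PE //; apply: eq_bigr => i _.
have /eqP := pF0 i _ (ltn_ord i) (hv i).
by rewrite linearB /= (pC i (c i)) ?hc // subr_eq0 => /eqP.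
Qed.

(** If the prefixes of length [p] differ, they already decide the comparison; if they agree, the
    inserted entries agree too and the suffixes decide. *)
Lemma lexi_insert (p : nat) (c1 c2 : nat) (s1 s2 : seqlexi nat) :
  (take p s1 = take p s2 -> c1 = c2) -> size s1 = size s2 -> (p <= size s1)%N ->
  (s1 < s2)%O ->
  ((take p s1 ++ c1 :: drop p s1 : seqlexi nat) < (take p s2 ++ c2 :: drop p s2 : seqlexi nat))%O.
Proof.
elim: p s1 s2 => [|p IHp] s1 s2 h.
  by move=> _ _ lt12; rewrite !take0 !drop0 !cat0s ltxi_cons (h _) ?take0 // lexx.
case: s1 s2 h => [|a1 t1] [|a2 t2] //= h [sz12]; rewrite ltnS => psz.
rewrite !ltxi_cons => /andP[le12 /implyP lt12]; rewrite le12 /=; apply/implyP => le21.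
have a12 : a1 = a2 by apply/eqP; rewrite eq_le le12.
by apply: IHp; rewrite ?lt12 // => e; apply: h; rewrite a12 e.
Qed.

(** * Morphisms as words *)

(** Indices are zero-based: this is the point [j + 1] of [[-n,n]]. *)
Definition pos_pt n (j : nat) : ptB n := inord (n + j.+1).

Lemma val_pos n j : (j < n)%N -> pos_pt n j = (n + j.+1)%N :> nat.
Proof. by move=> jn; rewrite inordK //; lia. Qed.

Variant ptB_spec n (x : ptB n) : Prop :=
| PtZero of x = n :> nat & rev_ord x = x
| PtPos j of (j < n)%N & x = pos_pt n j
| PtNeg j of (j < n)%N & x = rev_ord (pos_pt n j).

Lemma ptBP n (x : ptB n) : ptB_spec x.
Proof.
have xn := ltn_ord x.
case: (ltngtP x n) => h.
- apply: (@PtNeg _ _ (n - x.+1)%N); first lia.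
  by apply: val_inj; rewrite /= val_pos; lia.
- apply: (@PtPos _ _ (x - n.+1)%N); first lia.
  by apply: val_inj; rewrite /= val_pos; lia.
- by apply: PtZero => //; apply: val_inj => /=; lia.
Qed.

Section Homs.
Implicit Types l m n : nat.

Lemma homB_rev m n (f : homB m n) x : val f (rev_ord x) = rev_ord (val f x).
Proof. by case: f => f /= /andP[_ /forallP/(_ x)/eqP]. Qed.

Lemma homB_surj m n (f : homB m n) y : exists x, val f x = y.
Proof. by case: f => f /= /andP[/forallP/(_ y)/existsP[x /eqP <-] _]; exists x. Qed.

(** Equivariance sends the fixed point to the fixed point and determines the negative points from
    the positive ones. *)
Lemma homB_ext m n (f g : homB m n) :
  (forall j, (j < m)%N -> val f (pos_pt m j) = val g (pos_pt m j)) -> f = g.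
Proof.
move=> fg; apply/val_inj/ffunP => x; case: (ptBP x) => [xm xr|j jm ->|j jm ->].
- have fix0 (h : homB m n) : val h x = n :> nat.
    have := congr1 val (homB_rev h x); rewrite xr /= => e.
    by have := ltn_ord (val h x); lia.
  by apply: val_inj; rewrite /= !fix0.
- exact: fg.
- by rewrite !homB_rev fg.
Qed.

Lemma homB_comp_subproof l m n (f : homB l m) (g : homB m n) :
  isHomB [ffun x => val g (val f x)].
Proof.
apply/andP; split; apply/forallP => y.
  have [z <-] := homB_surj g y; have [x <-] := homB_surj f z.
  by apply/existsP; exists x; rewrite ffunE.
by rewrite !ffunE !homB_rev.
Qed.
Definition homB_comp l m n (f : homB l m) (g : homB m n) : homB l n :=
  Sub _ (homB_comp_subproof f g).

Lemma homB_compE l m n (f : homB l m) (g : homB m n) x :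
  val (homB_comp f g) x = val g (val f x).
Proof. by rewrite /= ffunE. Qed.

(** The odd extension of a map [th] between the zero-based indices of positive points. *)
Definition signed_ext m n (th : nat -> nat) (x : ptB m) : ptB n :=
  if (m < x)%N then pos_pt n (th (x - m.+1)%N)
  else if (x < m)%N then rev_ord (pos_pt n (th (m - x.+1)%N)) else inord n.

Lemma signed_ext_pos m n th j : (j < m)%N ->
  @signed_ext m n th (pos_pt m j) = pos_pt n (th j).
Proof.
move=> jm; rewrite /signed_ext val_pos // ifT; last lia.
by congr (pos_pt n (th _)); lia.
Qed.

Lemma signed_ext_subproof m n th : (forall j, (j < n)%N -> exists2 i, (i < m)%N & th i = j) ->
  isHomB [ffun x => @signed_ext m n th x].
Proof.
move=> ths.
have rev x : @signed_ext m n th (rev_ord x) = rev_ord (@signed_ext m n th x).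
  case: (ptBP x) => [xm xr|j jm ->|j jm ->].
  - rewrite xr /signed_ext xm ltnn; apply: val_inj; rewrite /= inordK; lia.
  - rewrite signed_ext_pos // /signed_ext /= val_pos // ifF ?ifT; try lia.
    by congr (rev_ord (pos_pt n (th _))); lia.
  - rewrite rev_ordK signed_ext_pos // /signed_ext /= val_pos // ifF ?ifT; try lia.
    by rewrite rev_ordK; congr (pos_pt n (th _)); lia.
apply/andP; split; apply/forallP => y; last by rewrite !ffunE rev.
apply/existsP; case: (ptBP y) => [yn yr|j /ths[i im <-] ->|j /ths[i im <-] ->].
- exists (inord m); rewrite ffunE /signed_ext inordK ?ltnn; last lia.
  by apply/eqP/val_inj; rewrite /= inordK; lia.
- by exists (pos_pt m i); rewrite ffunE signed_ext_pos.
- by exists (rev_ord (pos_pt m i)); rewrite ffunE rev signed_ext_pos.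
Qed.

Definition hom_word m n (f : homB m n) : seq (ptB n) := mkseq (fun j => val f (pos_pt m j)) m.

Lemma size_hom_word m n (f : homB m n) : size (hom_word f) = m.
Proof. exact: size_mkseq. Qed.

Lemma hom_word_inj m n : injective (@hom_word m n).
Proof.
move=> f g e; apply: homB_ext => j jm.
by have := congr1 (nth ord0 ^~ j) e; rewrite !nth_mkseq.
Qed.

(* Letter [j] of the word [w] with a copy of letter [p] inserted at position [q] is letter
   [dup_index p q j] of [w]. *)
Definition dup_index (p q j : nat) : nat :=
  if (j < q)%N then j else if j == q then p else j.-1.

Lemma dup_index_surj n p q : (p < q <= n)%N ->
  forall j, (j < n)%N -> exists2 i, (i < n.+1)%N & dup_index p q i = j.
Proof.
move=> /andP[pq qn] j jn; case: (ltnP j q) => jq.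
  by exists j; rewrite /dup_index ?jq //; lia.
by exists j.+1; rewrite // /dup_index ltnNge (leqW jq) /= gtn_eqF.
Qed.

Definition dup_hom n p q (h : (p < q <= n)%N) : homB n.+1 n :=
  Sub _ (signed_ext_subproof (dup_index_surj h)).

Lemma hom_word_dup n m p q (h : (p < q <= n)%N) (f : homB n m) :
  hom_word (homB_comp (dup_hom h) f) =
  take q (hom_word f) ++ nth ord0 (hom_word f) p :: drop q (hom_word f).
Proof.
have /andP[pq qn] := h.
have sz : size (take q (hom_word f)) = q by rewrite size_take size_hom_word; case: ltngtP qn.
apply: (@eq_from_nth _ ord0) => [|j].
  by rewrite size_hom_word size_cat sz /= size_drop size_hom_word; lia.
rewrite size_hom_word => jn; rewrite nth_mkseq // homB_compE /= ffunE signed_ext_pos //.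
rewrite nth_cat sz /dup_index; case: (ltngtP j q) => [jq|jq|->].
- by rewrite nth_take // nth_mkseq //; lia.
- case: j jq jn => // j jq jn; rewrite subSn //= nth_drop nth_mkseq; last lia.
  by congr (val f (pos_pt n _)); lia.
- by rewrite subnn /= nth_mkseq //; lia.
Qed.

End Homs.

(** * Initial words of submodules *)

Section InitialWords.
Variables (k : fieldType) (M : FSBmod k) (r : nat) (m : 'I_r -> nat).
Variable x : forall i, M (m i).

Definition free_index n := {i : 'I_r & homB n (m i)}.
Definition free_val n := {ffun free_index n -> k^o}.

(** Basis elements are compared by summand first, then lexicographically by word. The leading tag
    shifts all positions in the word by one. *)
Definition free_key n (t : free_index n) : seqlexi nat :=
  (tag t : nat) :: map val (hom_word (tagged t)).

Lemma free_key_inj n : injective (@free_key n).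
Proof.
move=> [i f] [j g] [/= /val_inj ij]; case: j / ij g => g.
by move=> /(inj_map val_inj)/hom_word_inj ->.
Qed.

Definition free_dup n p q (h : (p < q <= n)%N) (t : free_index n) : free_index n.+1 :=
  Tagged (fun i => homB n.+1 (m i)) (homB_comp (dup_hom h) (tagged t)).

Lemma free_key_dup n p q (h : (p < q <= n)%N) (t : free_index n) :
  free_key (free_dup h t) =
  take q.+1 (free_key t) ++ nth 0%N (free_key t) p.+1 :: drop q.+1 (free_key t).
Proof.
have -> : free_key (free_dup h t) =
    (tag t : nat) :: map val (hom_word (homB_comp (dup_hom h) (tagged t))) by [].
rewrite hom_word_dup map_cat map_cons map_take map_drop -(nth_map ord0 0%N) //.
by rewrite size_hom_word; lia.
Qed.

Lemma size_free_key n (t : free_index n) : size (free_key t) = n.+1.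
Proof. by rewrite /= size_map size_hom_word. Qed.

Lemma free_dup_mono n p q (h : (p < q <= n)%N) (s t : free_index n) :
  (free_key s < free_key t)%O -> (free_key (free_dup h s) < free_key (free_dup h t))%O.
Proof.
move=> st; rewrite !free_key_dup; apply: lexi_insert; rewrite ?size_free_key //; last lia.
(* As [p < q], the copied letter lies in the prefix, so equal prefixes insert equal letters. *)
by move=> /(congr1 (nth 0%N ^~ p.+1)); rewrite !nth_take //; lia.
Qed.

Lemma free_dup_inj n p q (h : (p < q <= n)%N) : injective (free_dup h).
Proof.
move=> s t e; apply: free_key_inj; case: (ltgtP (free_key s) (free_key t)) => // st.
  by have := free_dup_mono h st; rewrite e ltxx.
by have := free_dup_mono h st; rewrite e ltxx.
Qed.

(** The Yoneda map to [M] from the sum of the principal projectives, evaluated at [[-n,n]]. *)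
Definition free_eval n (c : free_val n) : M n :=
  \sum_t c t *: fsb_act M (tagged t) (x (tag t)).

Lemma free_eval_linear n : linear (@free_eval n).
Proof.
move=> a u v; rewrite /free_eval scaler_sumr -big_split; apply: eq_bigr => t _.
by rewrite !ffunE scalerDl scalerA.
Qed.

Definition free_lfun n := sval (exists_lfun (@free_eval_linear n)).
Lemma free_lfunE n c : free_lfun n c = free_eval c.
Proof. exact: svalP (exists_lfun (@free_eval_linear n)) c. Qed.

Definition initial_words (X : forall n, {vspace M n}) i (w : seq (ptB (m i))) :=
  exists n (f : homB n (m i)), hom_word f = w /\
    leading (@free_key n) (free_lfun n @^-1: X n) (Tagged (fun i => homB n (m i)) f).

Lemma fsb_act_sum n n' (g : homB n n') (I : finType) (F : I -> M n') :
  fsb_act M g (\sum_i F i) = \sum_i fsb_act M g (F i).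
Proof.
have [G GE] := exists_lfun (@fsb_lin _ M _ _ g).
by rewrite -GE linear_sum; apply: eq_bigr => i _; exact: GE.
Qed.

Lemma fsb_actZ n n' (g : homB n n') a (v : M n') :
  fsb_act M g (a *: v) = a *: fsb_act M g v.
Proof. by have [G GE] := exists_lfun (@fsb_lin _ M _ _ g); rewrite -!GE linearZ. Qed.

Lemma initial_words_closed X i : is_submod X -> insertion_closed finset.set0 (@initial_words X i).
Proof.
move=> Xsub u v b; rewrite finset.in_set0 /= => bu [n [f [fw [c cX [cf clt]]]]].
have szn : n = (size u + size v)%N by rewrite -size_cat -fw size_hom_word.
(* The letter copied is the first [b] in [u], and the copy is placed right after [u]. *)
have h : (index b u < size u <= n)%N by rewrite index_mem bu szn leq_addr.
exists n.+1, (homB_comp (dup_hom h) f); split.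
  by rewrite hom_word_dup fw take_size_cat // drop_size_cat // nth_cat index_mem bu nth_index.
(* The push-forward of [c] along [free_dup h], which is injective and strictly monotone and hence
   respects leading indices. *)
pose c' : free_val n.+1 := [ffun t => \sum_(s | free_dup h s == t) c s].
exists c'; first last.
  split.
    rewrite ffunE (big_pred1 (Tagged (fun i => homB n (m i)) f)) // => s /=.
    by rewrite -(inj_eq (free_dup_inj (h:=h))).
  move=> t lt_t; rewrite ffunE big1 // => s /eqP st; apply: clt.
  case: (ltgtP (free_key s) (free_key (Tagged (fun i => homB n (m i)) f))) => // [lt_s|eq_s].
    have := lt_trans lt_t; rewrite -st => /(_ _ (free_dup_mono h lt_s)).
    by rewrite ltxx.
  by move: lt_t; rewrite -st (free_key_inj eq_s) ltxx.
rewrite -memv_preim free_lfunE; move: cX; rewrite -memv_preim free_lfunE => cX.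
(* Naturality of the Yoneda map brings the problem back to stability of [X]. *)
suff -> : free_eval c' = fsb_act M (dup_hom h) (free_eval c) by exact: Xsub.
rewrite /free_eval fsb_act_sum.
transitivity (\sum_t \sum_(s | free_dup h s == t)
    c s *: fsb_act M (tagged (free_dup h s)) (x (tag s))).
  apply: eq_bigr => t _; rewrite ffunE scaler_suml; apply: eq_bigr => s /eqP <-.
  by [].
rewrite (exchange_big_dep predT) //=; apply: eq_bigr => s _.
rewrite (big_pred1 (free_dup h s)) => [|t /=]; last by rewrite eq_sym.
rewrite fsb_actZ; congr (_ *: _).
by apply: fsb_comp => y; rewrite homB_compE.
Qed.

Lemma dim_preim_initial_words X n :
  \dim (free_lfun n @^-1: X n) = (\sum_i word_count (@initial_words X i) n)%N.
Proof.
pose L i (f : homB n (m i)) :=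
  `[< leading (@free_key n) (free_lfun n @^-1: X n) (Tagged (fun i => homB n (m i)) f) >].
rewrite (dim_leading (@free_key_inj n)) -sum1dep_card.
rewrite (eq_bigl (fun t : free_index n => predT (tag t) && L (tag t) (tagged t))); last by case.
rewrite -(sig_big_dep (op := addn) predT L (fun _ _ => 1%N)); apply: eq_bigr => i _.
rewrite sum1dep_card word_countE.
pose wt (f : homB n (m i)) : n.-tuple (ptB (m i)) := Tuple (introT eqP (size_hom_word f)).
have wt_inj : injective wt by move=> f g /(congr1 val)/hom_word_inj.
rewrite -(card_imset _ wt_inj); apply: eq_card => w; rewrite [RHS]finset.inE.
apply/imsetP/asboolP => [[f + ->]|[n' [f [fw lf]]]].
  by rewrite finset.inE => /asboolP lf; exists n, f.
have nn : n = n' by rewrite -(size_tuple w) -fw size_hom_word.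
case: n' / nn in f fw lf *.
exists f; first by rewrite finset.inE; apply/asboolP.
by apply: val_inj.
Qed.

Lemma limg_free_lfun n :
  (forall v : M n, exists c : forall i, {ffun homB n (m i) -> k},
     v = \sum_(i < r) \sum_(f : homB n (m i)) c i f *: fsb_act M f (x i)) ->
  limg (free_lfun n) = fullv.
Proof.
move=> gen; apply/eqP; rewrite eqEsubv subvf; apply/subvP => v _.
have [c ->] := gen v.
apply/memv_imgP; exists [ffun t => c (tag t) (tagged t)]; rewrite ?memvf //.
rewrite free_lfunE /free_eval (sig_big_dep (op := +%R) predT (fun _ => predT)
  (fun i f => c i f *: fsb_act M f (x i))) /=.
by apply: eq_bigr => t _; rewrite ffunE.
Qed.

End InitialWords.

(** The number of initial words of [X] exceeds [\dim (X n)] by the dimension of the kernel of the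
    Yoneda map. Comparing two families eliminates this kernel. *)
Lemma fg_deg_dim_words (k : fieldType) (M : FSBmod k) (d : nat) : fg_deg M d ->
  exists (r : nat) (m : 'I_r -> nat) (I : (forall n, {vspace M n}) -> forall i, seq (ptB (m i)) -> Prop),
    [/\ forall i, (m i <= d)%N,
        forall X i, is_submod X -> insertion_closed finset.set0 (I X i) &
        forall X Y n, (\dim (X n) + \sum_i word_count (I Y i) n =
                       \dim (Y n) + \sum_i word_count (I X i) n)%N].
Proof.
move=> [r [m [x [md gen]]]]; exists r, m, (initial_words x); split=> //.
  by move=> X i; exact: initial_words_closed.
move=> X Y n; rewrite -!dim_preim_initial_words.
have dimE (Z : forall n, {vspace M n}) :
    \dim (free_lfun x n @^-1: Z n) = (\dim (lker (free_lfun x n)) + \dim (Z n))%N.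
  rewrite -(limg_ker_dim (free_lfun x n)) lpreimK; last first.
    by rewrite limg_free_lfun ?subvf //; exact: gen.
  by rewrite (capv_idPr _) // -lpreim0 lpreimS // sub0v.
by rewrite !dimE; lia.
Qed.

Lemma dsmallish_tame (k : fieldType) (R : realType) (d : nat) (N : FSBmod k) :
  dsmallish d N ->
  rational_series (2 * d + 1) (fun n => (dimB N n)%:R) /\
  growth_cvg (2 * d + 1) (fun n => (dimB N n)%:R : R).
Proof.
move=> [s [F [[F0 Fs Fle _] [M [A [B [q [fgM subA subB AB [qlin qF _ qsurj qA]]]]]]]]].
have dimNAB n : (dimB N n + \dim (A n))%N = \dim (B n).
  apply: (@filtered_dim _ _ _ _ _ s (F^~ n) (q^~ n)) => //.
  - by move=> i; exact: Fle.
  - by move=> i v; exact: qF.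
  - by move=> w; exact: qsurj.
  - by move=> v; exact: qA.
have [r [m [I [md Iclosed dimI]]]] := fg_deg_dim_words fgM.
have tame X i : is_submod X ->
    rational_series (2 * d + 1) (fun n => (word_count (I X i) n)%:R) /\
    growth_cvg (2 * d + 1) (fun n => (word_count (I X i) n)%:R : R).
  move=> subX; apply: (word_count_tame _ _ _ (Iclosed X i subX)); first lia.
  (* The alphabet [[-m i, m i]] has [2 (m i) + 1] letters; this is the source of the bound
     [2 d + 1]. *)
  by rewrite card_ord; have := md i; lia.
have dimN (K : pzRingType) n : (dimB N n)%:R =
    \sum_i (word_count (I B i) n)%:R + - \sum_i (word_count (I A i) n)%:R :> K.
  rewrite -!natr_sum -[LHS](addrK (\sum_i word_count (I A i) n)%:R) -natrD.
  by congr (_%:R - _); have := dimI A B n; have := dimNAB n; lia.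
split.
  rewrite (_ : (fun n => _) = (fun n => \sum_i (word_count (I B i) n)%:R
    + - \sum_i (word_count (I A i) n)%:R)); last by apply: funext => n; exact: dimN.
  apply: rational_seriesD; last apply: rational_seriesN;
  by apply: rational_series_sum => i _; apply tame.
rewrite (_ : (fun n => _) = (fun n => \sum_i (word_count (I B i) n)%:R
  + - \sum_i (word_count (I A i) n)%:R)); last by apply: funext => n; exact: dimN.
apply: growth_cvgD; last apply: growth_cvgN;
by apply: growth_cvg_sum => i _; apply tame.
Qed.

(** * Elements negated by signed permutations *)

Section SignedPermutations.
Variable n : nat.
Implicit Types g h : {perm ptB n}.
Implicit Types P Q : ptB n.

Lemma Wn_rev g x : g \in Wn n -> g (rev_ord x) = rev_ord (g x).
Proof. by rewrite finset.inE => /forallP/(_ x)/eqP. Qed.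

Lemma WnP g : (forall x, g (rev_ord x) = rev_ord (g x)) -> g \in Wn n.
Proof. by move=> h; rewrite finset.inE; apply/forallP => x; rewrite h. Qed.

Lemma Wn1 : 1%g \in Wn n.
Proof. by apply: WnP => x; rewrite !perm1. Qed.

Lemma WnM g h : g \in Wn n -> h \in Wn n -> (g * h)%g \in Wn n.
Proof. by move=> gW hW; apply: WnP => x; rewrite !permM !Wn_rev. Qed.

Lemma WnV g : g \in Wn n -> (g^-1)%g \in Wn n.
Proof.
by move=> gW; apply: WnP => x; apply: (@perm_inj _ g); rewrite permKV Wn_rev // permKV.
Qed.

Definition swapB P Q : {perm ptB n} := (tperm P Q * tperm (rev_ord P) (rev_ord Q))%g.
Definition flipB P : {perm ptB n} := tperm P (rev_ord P).

Lemma tperm_rev P Q x : tperm (rev_ord P) (rev_ord Q) (rev_ord x) = rev_ord (tperm P Q x).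
Proof. by rewrite inj_tperm //; exact: rev_ord_inj. Qed.

Lemma flipB_Wn P : flipB P \in Wn n.
Proof. by apply: WnP => x; rewrite -tperm_rev rev_ordK tpermC. Qed.

Lemma swapB_comm P Q : P != rev_ord P -> Q != rev_ord Q -> P != rev_ord Q ->
  commute (tperm P Q) (tperm (rev_ord P) (rev_ord Q)).
Proof.
move=> PP QQ PQ; apply/esym/commgP/conjg_fixP.
rewrite tpermJ !tpermD // 1?eq_sym //.
by rewrite -(inj_eq rev_ord_inj) rev_ordK.
Qed.

Lemma swapB_Wn P Q : P != rev_ord P -> Q != rev_ord Q -> P != rev_ord Q ->
  swapB P Q \in Wn n.
Proof.
move=> PP QQ PQ; apply: WnP => x.
rewrite {2}/swapB (swapB_comm PP QQ PQ) !permM -[in RHS]tperm_rev -[in LHS](rev_ordK P) -(rev_ordK Q).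
by rewrite !tperm_rev !rev_ordK.
Qed.

(** This serves morphisms that identify [P] with [-Q]: the action of the twisted swap is computed
    from a swap and two flips. *)
Lemma swapB_flip P Q : P != rev_ord P -> P != Q -> P != rev_ord Q ->
  swapB P (rev_ord Q) = (flipB Q * swapB P Q * flipB Q)%g.
Proof.
move=> PP PQ PrQ.
have rPQ : rev_ord P != Q by rewrite -(inj_eq rev_ord_inj) rev_ordK.
have rPrQ : rev_ord P != rev_ord Q by rewrite (inj_eq rev_ord_inj).
have -> : (flipB Q * swapB P Q * flipB Q = swapB P Q ^ flipB Q)%g.
  by rewrite conjgE [in RHS]/flipB tpermV -/(flipB Q) -(mulgA (flipB Q)).
by rewrite /swapB conjMg !tpermJ tpermL tpermR !(tpermD, rev_ordK) // eq_sym.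
Qed.

Lemma hom_tperm m (f : homB n m) P Q x : val f P = val f Q -> val f (tperm P Q x) = val f x.
Proof. by move=> fPQ; case: tpermP => // ->. Qed.

Lemma hom_swapB m (f : homB n m) P Q x : val f P = val f Q -> val f (swapB P Q x) = val f x.
Proof. by move=> fPQ; rewrite permM !hom_tperm // !homB_rev fPQ. Qed.

Lemma homB_id_subproof : isHomB [ffun x : ptB n => x].
Proof.
apply/andP; split; apply/forallP => x; last by rewrite !ffunE.
by apply/existsP; exists x; rewrite ffunE.
Qed.

(** The identity is the default value for permutations outside [Wn n]. *)
Definition hom_perm g : homB n n := insubd (Sub _ homB_id_subproof : homB n n) [ffun x => g x].

Lemma hom_permE g x : g \in Wn n -> val (hom_perm g) x = g x.
Proof.
move=> gW; rewrite insubdK ?ffunE //; apply/andP; split; apply/forallP => y.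
  by apply/existsP; exists (g^-1%g y); rewrite ffunE permKV.
by rewrite !ffunE Wn_rev.
Qed.

Variables (k : fieldType) (N : FSBmod k).
Definition perm_act g (v : N n) : N n := fsb_act N (hom_perm g) v.

Lemma perm_act1 v : perm_act 1 v = v.
Proof. by apply: fsb_id => x; rewrite hom_permE ?Wn1 // perm1. Qed.

Lemma perm_actM g h v : g \in Wn n -> h \in Wn n ->
  perm_act (g * h) v = perm_act g (perm_act h v).
Proof.
move=> gW hW; apply: fsb_comp => x; rewrite !hom_permE ?WnM //.
by rewrite permM.
Qed.

Lemma perm_act_is_linear g : linear (perm_act g).
Proof. exact: fsb_lin. Qed.

Lemma perm_actN g v : perm_act g (- v) = - perm_act g v.
Proof. by have [G GE] := exists_lfun (perm_act_is_linear g); rewrite -!GE linearN. Qed.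

End SignedPermutations.

(* If every [f : [-n,n] -> [-m,m]] with [m <= d] is fixed by a signed permutation negating [x],
   the signed sum over the stabiliser of [{x, -x}] kills all [M(f) y], hence all subquotients of
   [M], whereas it multiplies [x] by the order of that stabiliser. *)
Lemma dsmallish_antisym_eq0 (k : fieldType) (d n : nat) (N : FSBmod k) (x : N n) :
  [pchar k] =i pred0 -> dsmallish d N ->
  (forall m (f : homB n m), (m <= d)%N -> exists t : {perm ptB n},
     [/\ t \in Wn n, forall z, val f (t z) = val f z & perm_act t x = - x]) ->
  x = 0.
Proof.
move=> /pcharf0P char0 [s [F [[F0 Fs Fle Fsub] [M [A [B [q gr]]]]]]] anti.
have [[r [m [y [md gen]]]] _ subB _ [qlin qF qact qsurj _]] := gr.
apply/eqP; apply: contraT => x0.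
pose K := [set g in Wn n | (perm_act g x == x) || (perm_act g x == - x)].
have KE g : (g \in K) = (g \in Wn n) && ((perm_act g x == x) || (perm_act g x == - x)).
  by rewrite finset.in_set.
pose chi (g : {perm ptB n}) : k := if perm_act g x == x then 1 else -1.
have xNx : (- x == x) = false.
  apply/negbTE; rewrite eq_sym -addr_eq0 -mulr2n -scaler_nat scaler_eq0 negb_or x0 andbT.
  by rewrite char0.
have chiE g : g \in K -> perm_act g x = chi g *: x.
  rewrite KE /chi => /andP[_]; case: eqP => [->|_ /= /eqP ->]; first by rewrite scale1r.
  by rewrite scaleN1r.
have chi2 g : chi g * chi g = 1 by rewrite /chi; case: ifP; rewrite ?mulr1 ?mulrNN ?mulr1.
have KW g : g \in K -> g \in Wn n by rewrite KE => /andP[].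
have K0 : (#|K|%:R : k) != 0.
  by rewrite char0 -lt0n; apply/card_gt0P; exists 1%g; rewrite KE Wn1 perm_act1 eqxx.
pose e (L : FSBmod k) (v : L n) := \sum_(g in K) chi g *: perm_act g v.
have e_lin L : linear (e L).
  move=> a u v; rewrite scaler_sumr -big_split; apply: eq_bigr => g _ /=.
  by rewrite perm_act_is_linear scalerDr !scalerA mulrC.
(* Right translation by [t] preserves [K], reverses [chi] and fixes [M(f) y], so the sum equals its
   own negative. *)
have e_gen i (f : homB n (m i)) : e M (fsb_act M f (y i)) = 0.
  have [t [tW ft tx]] := anti _ f (md i).
  have Kt g : ((g * t)%g \in K) = (g \in K).
    have [gW|gW] := boolP (g \in Wn n); last first.
      rewrite 2!KE (negbTE gW) /=; apply/negbTE; rewrite negb_and; apply/orP; left.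
      by apply: contra gW => gtW; rewrite -(mulgK t g) WnM ?WnV.
    rewrite 2!KE gW WnM // perm_actM // tx perm_actN eqr_oppLR eqr_opp.
    by rewrite orbC.
  have chit g : g \in K -> chi (g * t)%g = - chi g.
    move=> gK; have := chiE g gK; rewrite /chi (perm_actM x (KW g gK) tW) tx perm_actN.
    case: eqP => [-> _|_ ->]; first by rewrite xNx.
    by rewrite scaleN1r opprK eqxx opprK.
  have eN : e M (fsb_act M f (y i)) = - e M (fsb_act M f (y i)).
    rewrite {1}/e (reindex_inj (mulIg t)) /= (eq_bigl _ _ Kt) -sumrN; apply: eq_bigr => g gK.
    rewrite chit // scaleNr; congr (- (_ *: _)).
    rewrite (perm_actM _ (KW g gK) tW); congr (perm_act g _); apply/esym/fsb_comp => z.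
    by rewrite hom_permE // ft.
  move/eqP: eN; rewrite -addr_eq0 -mulr2n -scaler_nat scaler_eq0 char0 /=.
  by move/eqP.
have e0 v : e M v = 0.
  have [c ->] := gen n v; have [E EE] := exists_lfun (e_lin M).
  rewrite -EE linear_sum big1 // => i _; rewrite linear_sum big1 // => f _.
  by rewrite linearZ /= EE e_gen scaler0.
(* Lift [x] to [v] in [B], modulo [F i]. Since [e M v = 0] and [q i.+1] is natural modulo [F i],
   also [e N x] lies in [F i]. *)
have step i : (i < s)%N -> x \in F i.+1 n -> x \in F i n.
  move=> is_ xF.
  have [j|v vB hv] := qsurj n (fun j => if j == Ordinal is_ then x else 0).
    by case: eqP => [->|_]; rewrite ?mem0v.
  have := hv (Ordinal is_); rewrite eqxx => {hv} /= hv.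
  have i_range : (0 < i.+1 <= s)%N by [].
  have q0 : q i.+1 n 0 = 0.
    by have [G GE] := exists_lfun (qlin i.+1 n); rewrite -GE linear0.
  have eF u : u \in F i n -> e N u \in F i n.
    move=> uF; apply: rpred_sum => g _; apply: rpredZ.
    by apply: (Fsub i); rewrite // ltnW.
  have eq_e : e N (q i.+1 n v) \in F i n.
    have [G GE] := exists_lfun (qlin i.+1 n).
    rewrite -[e N _]subr0 -q0 -(e0 v) -[q _ _ (e M v)]GE /e linear_sum -sumrB; apply: rpred_sum => g _.
    rewrite linearZ -scalerBr; apply: rpredZ; rewrite -opprB rpredN /= GE.
    exact: (qact i.+1).
  have : e N x \in F i n.
    have [E EE] := exists_lfun (e_lin N).
    have -> : e N x = e N (q i.+1 n v) - e N (q i.+1 n v - x).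
      by rewrite -!EE -linearB subKr.
    by rewrite rpredB // eF.
  (* As [chi g] squares to 1, each summand is [x], so [e N x] is [#|K|] times [x]. *)
  rewrite /e (eq_bigr (fun=> x)); last first.
    by move=> g gK; rewrite chiE // scalerA chi2 scale1r.
  rewrite sumr_const -scaler_nat => /(rpredZ (#|K|%:R)^-1).
  by rewrite scalerA mulVf // scale1r.
have down i : (i <= s)%N -> x \in F i n -> x \in F 0%N n.
  by elim: i => // i IHi is_ /(step _ is_); exact: IHi (ltnW is_).
have : x \in F 0%N n by apply: (down s); rewrite // Fs memvf.
by rewrite F0 memv0 (negbTE x0).
Qed.

(** Convertible with [absB], but independent of a pair of partitions. *)
Definition abs_pt n (x : ptB n) : nat := if (n <= x)%N then (x - n)%N else (n - x)%N.

Lemma abs_pt_pos n j : (j < n)%N -> abs_pt (pos_pt n j) = j.+1.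
Proof. by move=> jn; rewrite /abs_pt val_pos // leq_addr addKn. Qed.

Lemma abs_pt_rev n (x : ptB n) : abs_pt (rev_ord x) = abs_pt x.
Proof. by rewrite /abs_pt /=; have := ltn_ord x; do 2 case: ifP; lia. Qed.

Lemma abs_pt_le n (x : ptB n) : (abs_pt x <= n)%N.
Proof. by rewrite /abs_pt; have := ltn_ord x; case: ifP; lia. Qed.

Lemma abs_pt_inj n (x y : ptB n) : abs_pt x = abs_pt y -> x = y \/ x = rev_ord y.
Proof.
rewrite /abs_pt; have := ltn_ord x; have := ltn_ord y => hy hx.
move=> h; have [e'|e'] : x = y :> nat \/ x = (n.*2.+1 - y.+1)%N :> nat.
  by move: h; do 2 case: ifP; lia.
  by left; apply: val_inj.
by right; apply: val_inj.
Qed.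

Lemma abs_pt_eq0 n (x : ptB n) : abs_pt x = 0%N -> rev_ord x = x.
Proof. by rewrite /abs_pt => h; apply: val_inj => /=; have := ltn_ord x; move: h; case: ifP; lia. Qed.

Lemma pos_neq_rev n i j : (i < n)%N -> (j < n)%N -> pos_pt n i != rev_ord (pos_pt n j).
Proof. by move=> hi hj; apply/eqP => /(congr1 (@nat_of_ord _)); rewrite /= !val_pos //; lia. Qed.

Lemma pos_inj n i j : (i < n)%N -> (j < n)%N -> pos_pt n i = pos_pt n j -> i = j.
Proof. by move=> hi hj /(congr1 (@nat_of_ord _)); rewrite !val_pos //; lia. Qed.

(** Pigeonhole on the absolute values of [f] at the [l] points. Two equal values give a swap,
    perhaps twisted by a sign, that fixes [f] and negates [x]. When [eps] is true, a point sent to 0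
    gives such an element by its flip. *)
Lemma antisym_positions_bound (k : fieldType) (d n l : nat) (N : FSBmod k) (x : N n)
    (c : 'I_l -> nat) (eps : bool) :
  [pchar k] =i pred0 -> dsmallish d N -> x != 0 ->
  injective c -> (forall i, (c i < n)%N) ->
  (forall i j, i != j -> perm_act (swapB (pos_pt n (c i)) (pos_pt n (c j))) x = - x) ->
  (forall i, perm_act (flipB (pos_pt n (c i))) x = (-1) ^+ eps *: x) ->
  (l + eps <= d.+1)%N.
Proof.
move=> char0 dN x0 c_inj cn swp flp; rewrite leqNgt; apply/negP => dl.
case/eqP: x0; apply: (dsmallish_antisym_eq0 char0 dN) => m f md.
pose P i := pos_pt n (c i).
have [/existsP[i /andP[he /eqP fi]]|] :=
    boolP [exists i, eps && (rev_ord (val f (P i)) == val f (P i))].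
  exists (flipB (P i)); split; [exact: flipB_Wn| |by rewrite flp he expr1 scaleN1r].
  by move=> z; apply: hom_tperm; rewrite homB_rev.
rewrite negb_exists => /forallP nz.
pose a i : 'I_m.+1 := inord (abs_pt (val f (P i))).
have aE i : a i = abs_pt (val f (P i)) :> nat by rewrite inordK // ltnS abs_pt_le.
have /injectivePn[i [j ij aij]] : ~~ injectiveb a.
  apply/negP => /injectiveP a_inj.
  have : (#|a @: [set: 'I_l]| <= #|[set b : 'I_m.+1 | eps ==> (b != ord0)]|)%N.
    apply: subset_leq_card; apply/fintype.subsetP => _ /imsetP[i _ ->]; rewrite finset.inE.
    apply/implyP => he; apply: contra (nz i) => /eqP ai0; rewrite he /=.
    by apply/eqP/abs_pt_eq0; rewrite -aE ai0.
  rewrite card_imset // cardsT card_ord leqNgt; apply/negP; rewrite negbK.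
  (* The value 0 has been excluded exactly when [eps] is true, which leaves [m + 1 - eps] values. *)
  have -> : #|[set b : 'I_m.+1 | eps ==> (b != ord0)]| = (m.+1 - eps)%N.
    case: (eps) => /=; last first.
      by rewrite subn0 -[RHS]card_ord -cardsT; apply: eq_card => b; rewrite !finset.inE.
    rewrite subn1 -[in RHS](card_ord m.+1) -(cardsC1 (ord0 : 'I_m.+1)).
    by apply: eq_card => b; rewrite !finset.inE.
  move: dl md; case: (eps); lia.
have PQ : P i != P j by apply: contra ij => /eqP/pos_inj-/(_ (cn _) (cn _))/c_inj ->.
have rPQ i' j' : P i' != rev_ord (P j') by exact: pos_neq_rev.
have : abs_pt (val f (P i)) = abs_pt (val f (P j)) by rewrite -!aE aij.
case/abs_pt_inj => fij.
  exists (swapB (P i) (P j)); split; [exact: swapB_Wn| |exact: swp].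
  by move=> z; apply: hom_swapB.
exists (swapB (P i) (rev_ord (P j))); split.
- by apply: swapB_Wn; rewrite ?rev_ordK // eq_sym.
- by move=> z; apply: hom_swapB; rewrite homB_rev.
have sW : swapB (P i) (P j) \in Wn n by exact: swapB_Wn.
have fW := flipB_Wn (P j).
(* The two flips contribute [(-1) ^+ eps] twice, so only the sign of the swap survives. *)
rewrite swapB_flip // (perm_actM _ (WnM fW sW) fW) (perm_actM _ fW sW).
have actZ (g : {perm ptB n}) (v : N n) : perm_act g ((-1) ^+ eps *: v) = (-1) ^+ eps *: perm_act g v.
  by have [G GE] := exists_lfun (@perm_act_is_linear n k N g); rewrite -!GE linearZ.
rewrite flp !actZ swp // perm_actN flp scalerN scalerA -signr_addb addbb.
by rewrite scale1r.
Qed.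

(** * Polytabloids and the induced modules *)

Section Polytabloids.
Variables (k : fieldType) (l : seq nat).
Local Notation S := (sumn l).
Implicit Types (t : tabl l) (s T pi : {perm 'I_S}).

Definition tabl_perm t pi : tabl l := [ffun x => t (pi x)].

Lemma tabl_perm_tabloid t pi T s :
  (tabl_perm t pi == @tabloid_of l T s) = (t == @tabloid_of l T (s * pi)%g).
Proof.
apply/eqP/eqP => [e|->]; apply/ffunP => x; last first.
  by rewrite !ffunE invMg permM permK.
by move/ffunP/(_ (pi^-1%g x)): e; rewrite !ffunE permKV invMg permM.
Qed.

Lemma polytab_perm T t pi : @polytab k l T (tabl_perm t pi) = @polytab k l (T * pi)%g t.
Proof.
rewrite /polytab [RHS](reindex_inj (conjg_inj pi)) /=.
have conjE s x : (s ^ pi)%g x = pi (s (pi^-1%g x)) by rewrite conjgE !permM.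
apply: eq_big => s.
  apply/forallP/forallP => h x.
    by rewrite conjE invMg !permM permK; exact: h.
  by have := h (pi x); rewrite conjE invMg !permM !permK.
move=> _; rewrite odd_permJ tabl_perm_tabloid; congr (_ * (_ == _)%:R).
by apply/ffunP => x; rewrite !ffunE -conjVg conjgE !invMg !permM !permK.
Qed.

(** The transposition lies in the column stabiliser of [T]; translating the signed sum by it changes
    the sign. *)
Lemma polytab_antisym T t (c1 c2 : 'I_S) : c1 != c2 -> Defs.col0 l c1 = Defs.col0 l c2 ->
  @polytab k l T (tabl_perm t (tperm (T c1) (T c2))) = - @polytab k l T t.
Proof.
move=> c12 col12; set tau := tperm _ _.
have tau_col x : Defs.col0 l ((T^-1)%g (tau x)) = Defs.col0 l ((T^-1)%g x).
  by rewrite /tau; case: tpermP => [->|->|//]; rewrite !permK.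
rewrite /polytab [in RHS](reindex_inj (mulIg tau)) /= -sumrN; apply: eq_big => s.
  by apply: eq_forallb => x; rewrite permM tau_col.
move=> _; rewrite tabl_perm_tabloid odd_permM odd_tperm (inj_eq perm_inj) c12.
by rewrite signr_addb expr1 mulrN1 mulNr opprK.
Qed.

Hypothesis lP : is_partition l.

Definition row_start (r : nat) := sumn (take r l).

Lemma row_start_mono r r' : (r <= r')%N -> (row_start r <= row_start r')%N.
Proof.
move=> /subnKC <-; rewrite /row_start.
by rewrite takeD sumn_cat leq_addr.
Qed.

Lemma row_start_ltS r : (r < size l)%N -> (row_start r < row_start r.+1)%N.
Proof.
move=> rl; rewrite /row_start (take_nth 0%N rl) sumn_rcons -[X in (X < _)%N]addn0 ltn_add2l.
by have /andP[_ /allP] := lP; apply; rewrite mem_nth.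
Qed.

Lemma row_start_lt r : (r < size l)%N -> (row_start r < S)%N.
Proof.
move=> rl; apply: leq_trans (row_start_ltS rl) _.
by rewrite -[X in (_ <= X)%N](congr1 sumn (cat_take_drop r.+1 l)) sumn_cat leq_addr.
Qed.

Lemma row0_row_start r : (r < size l)%N -> Defs.row0 l (row_start r) = r.
Proof.
move=> rl; rewrite /Defs.row0; set a := fun _ => _.
have har : a r by exact: row_start_ltS.
have hasa : has a (iota 0 (size l)) by apply/hasP; exists r; rewrite ?mem_iota.
set r0 := find _ _; case: (ltngtP r0 r) => // h.
  have := nth_find 0%N hasa; rewrite -/r0 nth_iota ?add0n; last first.
    exact: ltn_trans h rl.
  by rewrite /a ltnNge (row_start_mono h).
by have := before_find 0%N h; rewrite nth_iota // add0n har.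
Qed.

(** The cell of row [r] in the first column; positivity of the parts makes these cells distinct. *)
Definition col_cell (r : 'I_(size l)) : 'I_S := Ordinal (row_start_lt (ltn_ord r)).

Lemma col0_cell r : Defs.col0 l (col_cell r) = 0%N.
Proof. by rewrite /Defs.col0 /= row0_row_start ?ltn_ord // subnn. Qed.

Lemma col_cell_inj : injective col_cell.
Proof.
move=> r r' /(congr1 val) /= e; apply: val_inj => /=.
by rewrite -(row0_row_start (ltn_ord r)) e row0_row_start ?ltn_ord.
Qed.

End Polytabloids.

Lemma abs_pt_Wn n (h : {perm ptB n}) x y : h \in Wn n ->
  abs_pt x = abs_pt y -> abs_pt (h x) = abs_pt (h y).
Proof. by move=> hW /abs_pt_inj[->//|->]; rewrite Wn_rev // abs_pt_rev. Qed.

Lemma abs_pt_Wn_inj n (h : {perm ptB n}) x y : h \in Wn n ->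
  abs_pt (h x) = abs_pt (h y) -> abs_pt x = abs_pt y.
Proof. by move=> hW /(abs_pt_Wn (WnV hW)); rewrite !permK. Qed.

Lemma swapB_pos n i j z : (i < n)%N -> (j < n)%N -> (z < n)%N ->
  swapB (pos_pt n i) (pos_pt n j) (pos_pt n z) =
  pos_pt n (if z == i then j else if z == j then i else z).
Proof.
move=> hi hj hz.
have posrev u v : (u < n)%N -> (v < n)%N -> rev_ord (pos_pt n u) != pos_pt n v.
  by move=> hu hv; rewrite eq_sym pos_neq_rev.
have posne u v : (u < n)%N -> (v < n)%N -> u != v -> pos_pt n u != pos_pt n v.
  by move=> hu hv; apply: contra => /eqP/pos_inj ->.
rewrite permM; case: eqP => [->|/eqP zi]; first by rewrite tpermL tpermD ?posrev.
case: eqP => [->|/eqP zj]; first by rewrite tpermR tpermD ?posrev.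
by rewrite !tpermD ?posrev ?posne // eq_sym.
Qed.

Lemma flipB_pos n i z : (i < n)%N -> (z < n)%N ->
  flipB (pos_pt n i) (pos_pt n z) =
  if z == i then rev_ord (pos_pt n i) else pos_pt n z.
Proof.
move=> hi hz; rewrite /flipB; case: eqP => [->|zi]; first by rewrite tpermL.
rewrite tpermD //; first by apply/eqP => /pos_inj e; apply: zi; rewrite e.
by rewrite eq_sym pos_neq_rev.
Qed.

(** * Generators of the induced module *)

Section Induced.
Variables (k : fieldType) (lam mu : seq nat).
Local Notation a := (sumn lam).
Local Notation b := (sumn mu).
Local Notation n := (a + b)%N.
Local Notation pos := (pos_pt n).
Implicit Types (h g : {perm ptB n}) (pA : {perm 'I_a}) (pB : {perm 'I_b}).

(** The underlying unsigned permutations of the two blocks, as genuine permutations in place of the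
    natural numbers [piA] and [piB]. *)
Definition block_perm h pA pB :=
  [/\ h \in Wn n, forall x : 'I_a, abs_pt (h (pos x)) = (pA x).+1
    & forall y : 'I_b, abs_pt (h (pos (a + y))) = (a + pB y).+1].

Lemma ltA (x : 'I_a) : (x < n)%N. Proof. exact: ltn_addr. Qed.
Lemma ltB (y : 'I_b) : (a + y < n)%N. Proof. by rewrite ltn_add2l. Qed.
Hint Resolve ltA ltB : core.

Lemma posBE (y : 'I_b) : @posB lam mu y = pos (a + y).
Proof. by rewrite /posB /pos_pt -addnS addnA. Qed.

Lemma block_permM h g pA pB qA qB : block_perm h pA pB -> block_perm g qA qB ->
  block_perm (h * g)%g (pA * qA)%g (pB * qB)%g.
Proof.
move=> [hW hA hB] [gW gA gB]; split; first exact: WnM.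
  by move=> x; rewrite !permM -gA; apply: abs_pt_Wn; rewrite // hA abs_pt_pos.
by move=> y; rewrite !permM -gB; apply: abs_pt_Wn; rewrite // hB abs_pt_pos.
Qed.

Lemma block_permV h pA pB : block_perm h pA pB -> block_perm (h^-1)%g (pA^-1)%g (pB^-1)%g.
Proof.
move=> [hW hA hB]; split; first exact: WnV.
  move=> x; rewrite -[RHS](abs_pt_pos (ltA _)) -(permK h (pos ((pA^-1)%g x))).
  by apply: (abs_pt_Wn (WnV hW)); rewrite hA permKV abs_pt_pos.
move=> y; rewrite -[RHS](abs_pt_pos (ltB _)) -(permK h (pos (a + (pB^-1)%g y))).
by apply: (abs_pt_Wn (WnV hW)); rewrite hB permKV abs_pt_pos.
Qed.

Lemma block_perm_Hsub h pA pB : block_perm h pA pB -> h \in Hsub lam mu.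
Proof.
move=> [hW hA _]; rewrite finset.in_set hW; apply/forallP => x.
by rewrite -[absB _]/(abs_pt (h (pos x))) hA ltn_ord.
Qed.

(** Membership in [Hsub] only constrains the first block. The values there exhaust the absolute
    values [1..a], so injectivity forces the second block to be preserved. *)
Lemma Hsub_block_perm h : h \in Hsub lam mu -> exists pA pB, block_perm h pA pB.
Proof.
rewrite finset.in_set => /andP[hW /forallP hA'].
have hA (x : 'I_a) : (1 <= abs_pt (h (pos x)) <= a)%N := hA' x.
pose fA (x : 'I_a) : 'I_a := insubd x (abs_pt (h (pos x))).-1.
have fAE x : (fA x).+1 = abs_pt (h (pos x)).
  have := hA x => /andP[h1 h2].
  by rewrite /fA val_insubd prednK // h2 prednK.
have fA_inj : injective fA.
  move=> x y /(congr1 (fun z : 'I_a => z.+1)); rewrite !fAE => /(abs_pt_Wn_inj hW).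
  by rewrite !abs_pt_pos // => -[] /val_inj.
have hB (y : 'I_b) : (a < abs_pt (h (pos (a + y))) <= n)%N.
  rewrite abs_pt_le andbT ltnNge; apply/negP => le_a.
  have [abs0|abs_gt0] := posnP (abs_pt (h (pos (a + y)))).
    have := abs_pt_eq0 abs0; rewrite -Wn_rev // => /perm_inj/eqP.
    by rewrite eq_sym (negbTE (pos_neq_rev _ _)).
  have pa : ((abs_pt (h (pos (a + y)))).-1 < a)%N by rewrite prednK.
  pose x := (perm fA_inj)^-1%g (Ordinal pa).
  have /(abs_pt_Wn_inj hW) : abs_pt (h (pos x)) = abs_pt (h (pos (a + y))).
    by rewrite -fAE -(permE fA_inj) permKV /= prednK.
  by rewrite !abs_pt_pos // => -[]; have := ltn_ord x; lia.
pose fB (y : 'I_b) : 'I_b := insubd y (abs_pt (h (pos (a + y))) - a.+1)%N.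
have fBE y : (a + fB y).+1 = abs_pt (h (pos (a + y))).
  have := hB y => /andP[h1 h2].
  by rewrite /fB val_insubd ifT; lia.
have fB_inj : injective fB.
  move=> x y /(congr1 (fun z : 'I_b => (a + z).+1)); rewrite !fBE => /(abs_pt_Wn_inj hW).
  by rewrite !abs_pt_pos // => -[] /addnI/val_inj.
by exists (perm fA_inj), (perm fB_inj); split=> // x; rewrite permE.
Qed.

Lemma twist_block h pA pB (q : tabl lam * tabl mu) : block_perm h pA pB ->
  twist h q = (tabl_perm q.1 pA^-1%g, tabl_perm q.2 pB^-1%g).
Proof.
move=> /block_permV[hW hA hB]; congr (_, _); apply/ffunP => x; rewrite !ffunE.
  have -> : piA h^-1%g x = pA^-1%g x.
    by rewrite /piA -[absB _]/(abs_pt (h^-1%g (pos x))) hA.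
  by rewrite valK.
have -> : piB h^-1%g x = pB^-1%g x.
  by rewrite /piB -[absB _]/(abs_pt (h^-1%g (posB lam x))) posBE hB subSS addKn.
by rewrite valK.
Qed.

Lemma twistM h g q : h \in Hsub lam mu -> g \in Hsub lam mu ->
  twist (h * g)%g q = twist g (twist h q).
Proof.
move=> /Hsub_block_perm[pA [pB hb]] /Hsub_block_perm[qA [qB gb]].
rewrite (twist_block _ (block_permM hb gb)) (twist_block _ gb) (twist_block _ hb) /=.
by congr (_, _); apply/ffunP => x; rewrite !ffunE invMg permM.
Qed.

Lemma HsubM h g : h \in Hsub lam mu -> g \in Hsub lam mu -> (h * g)%g \in Hsub lam mu.
Proof.
move=> /Hsub_block_perm[pA [pB hb]] /Hsub_block_perm[qA [qB gb]].
exact: block_perm_Hsub (block_permM hb gb).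
Qed.

Lemma HsubV h : h \in Hsub lam mu -> (h^-1)%g \in Hsub lam mu.
Proof. by move=> /Hsub_block_perm[pA [pB /block_permV/block_perm_Hsub]]. Qed.

Lemma HsubMl h g : h \in Hsub lam mu -> ((h * g)%g \in Hsub lam mu) = (g \in Hsub lam mu).
Proof.
move=> hH; apply/idP/idP => [hgH|]; last exact: HsubM.
by rewrite -(mulKg h g) HsubM ?HsubV.
Qed.

Lemma Hsub_Wn h : h \in Hsub lam mu -> h \in Wn n.
Proof. by move=> /Hsub_block_perm[pA [pB []]]. Qed.

Lemma sgnB_prod h : @sgnB k lam mu h = \prod_(y : 'I_b) (-1) ^+ (h (pos (a + y)) < n)%N.
Proof.
rewrite /sgnB -prodr_const big_mkcond; apply: eq_bigr => y _.
by rewrite inE posBE; case: ifP.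
Qed.

(** The product changes the sign at [y] when exactly one of [h] at [y] and [g] at [pB y] does;
    reindexing by [pB] separates the two products. *)
Lemma sgnBM h g : h \in Hsub lam mu -> g \in Hsub lam mu ->
  @sgnB k lam mu (h * g)%g = @sgnB k lam mu h * @sgnB k lam mu g.
Proof.
move=> /Hsub_block_perm[pA [pB [hW _ hB]]] /Hsub_block_perm[qA [qB [gW _ gB]]].
rewrite !sgnB_prod [X in _ = _ * X](reindex_inj (@perm_inj _ pB)) -big_split /=.
apply: eq_bigr => y _; rewrite permM -signr_addb; congr ((-1) ^+ (nat_of_bool _)).
have /abs_pt_inj[->|->] : abs_pt (h (pos (a + y))) = abs_pt (pos (a + pB y)).
- by rewrite hB abs_pt_pos.
- by have -> : (pos (a + pB y) < n)%N = false by rewrite val_pos // ltnNge leq_addr.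
rewrite Wn_rev //=; have := gB (pB y); rewrite /abs_pt val_pos //.
by have := ltn_ord (g (pos (a + pB y))); case: ifP; lia.
Qed.

Definition polytab2 (T : {perm 'I_a} * {perm 'I_b}) (q : tabl lam * tabl mu) : k :=
  polytab k T.1 q.1 * polytab k T.2 q.2.

(** The element of the induced module supported on the subgroup [Hsub], with value the product of
    two polytabloids at the identity. *)
Definition generator T : AmbV k lam mu :=
  [ffun q => if q.1 \in Hsub lam mu then sgnB k q.1 * polytab2 T (twist q.1 q.2) else 0].

Lemma generator_inV T : inV (generator T).
Proof.
split.
- by move=> g q gW; rewrite ffunE /= ifF //; apply: contraNF gW; exact: Hsub_Wn.
- move=> h g q hH gW; rewrite !ffunE /= HsubMl //; case: ifP => gH; last by rewrite mulr0.
  by rewrite sgnBM // twistM // mulrA.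
- move=> g gW; have [gH|gH] := boolP (g \in Hsub lam mu); last first.
    exists [ffun=> 0] => q; rewrite ffunE /= (negbTE gH) big1 // => U _.
    by rewrite ffunE mul0r.
  have [pA [pB gb]] := Hsub_block_perm gH.
  exists [ffun U => sgnB k g * (U == (T.1 * pA^-1, T.2 * pB^-1)%g)%:R] => q.
  rewrite ffunE /= gH (bigD1 (T.1 * pA^-1, T.2 * pB^-1)%g) //= big1 ?addr0; last first.
    by move=> U /negPf neU; rewrite ffunE neU mulr0 mul0r.
  by rewrite ffunE eqxx mulr1 (twist_block _ gb) /polytab2 /= !polytab_perm.
Qed.

Lemma gactV_generator t pA pB T eps : block_perm t pA pB ->
  (forall q, @sgnB k lam mu t * polytab2 T (tabl_perm q.1 pA^-1%g, tabl_perm q.2 pB^-1%g)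
     = eps * polytab2 T q) ->
  Defs.gactV t (generator T) = eps *: generator T.
Proof.
move=> tb te; apply/ffunP => -[g q]; have tH := block_perm_Hsub tb.
rewrite !ffunE /=; have -> : ((g * t)%g \in Hsub lam mu) = (g \in Hsub lam mu).
  apply/idP/idP => [gtH|gH]; last exact: HsubM.
  by rewrite -(mulgK t g) HsubM ?HsubV.
case: ifP => gH; last by rewrite scaler0.
rewrite sgnBM // twistM // (twist_block (twist g q) tb) -mulrA te.
by rewrite /GRing.scale /= mulrCA.
Qed.

(** Summing over all of [Wn n] avoids coset representatives: each value of [f] is then reached
    [#|Hsub lam mu|] times, a factor invertible in characteristic zero. *)
Lemma generator_spans (V : vectType k) (phi : AmbV k lam mu -> V) (f : AmbV k lam mu) :
  [pchar k] =i pred0 -> linear phi -> inV f -> phi f != 0 ->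
  exists g T, g \in Wn n /\ phi (Defs.gactV g (generator T)) != 0.
Proof.
move=> /pcharf0P char0 philin [f0 fH fT] phif.
apply: contrapT => /forallNP none.
have {}none g T : g \in Wn n -> phi (Defs.gactV g (generator T)) = 0.
  move=> gW; apply/eqP; apply: contrapT => /negP h.
  by apply: (none g); exists T.
have /boolp.choice[c cE] : forall g, exists c : {ffun {perm 'I_a} * {perm 'I_b} -> k},
    g \in Wn n -> forall q, f (g, q) = \sum_T c T * polytab2 T q.
  move=> g; have [gW|gW] := boolP (g \in Wn n); last by exists [ffun=> 0].
  by have [c cE] := fT g gW; exists c.
pose F : {linear AmbV k lam mu -> V} :=
  HB.pack phi (GRing.isLinear.Build _ _ _ _ phi philin).
have H0 : (#|Hsub lam mu|%:R : k) != 0.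
  rewrite char0 -lt0n; apply/card_gt0P; exists 1%g; apply: (@block_perm_Hsub _ 1%g 1%g).
  by split=> [|x|y]; rewrite ?Wn1 // !perm1 abs_pt_pos.
have fE : #|Hsub lam mu|%:R *: f = \sum_(g in Wn n) \sum_T
    c g T *: Defs.gactV (g^-1)%g (generator T).
  apply/ffunP => -[u q].
  transitivity (\sum_(g in Wn n) if (u * g^-1)%g \in Hsub lam mu then f (u, q) else 0).
    rewrite (reindex_inj (inj_comp (mulIg u) invg_inj)) /= ffunE.
    have [uW|uW] := boolP (u \in Wn n); last first.
      by rewrite f0 // scaler0 big1 // => g _; rewrite if_same.
    rewrite big_mkcond /= -[LHS]/(#|Hsub lam mu|%:R * f (u, q)) mulr_natl -sumr_const.
    rewrite [LHS]big_mkcond /=; apply: eq_bigr => h _; rewrite invMg invgK mulKVg.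
    case: (boolP (h \in Hsub lam mu)) => hH; last by rewrite if_same.
    by rewrite WnM // WnV // Hsub_Wn.
  rewrite sum_ffunE; apply: eq_bigr => g gW; rewrite sum_ffunE.
  case: ifP => uH; last first.
    by rewrite big1 // => T _; rewrite !ffunE /= uH scaler0.
  rewrite -{1}(mulgKV g u) fH // cE // mulr_sumr; apply: eq_bigr => T _.
  by rewrite !ffunE /= uH [RHS]mulrCA.
have phiZ c1 v : phi (c1 *: v) = c1 *: phi v.
  by rewrite -[in LHS](addr0 (c1 *: v)) philin (linear0 F : phi 0 = 0) addr0.
have phi_sum (I : finType) (P : pred I) (G : I -> AmbV k lam mu) :
    phi (\sum_(i | P i) G i) = \sum_(i | P i) phi (G i) by exact: (linear_sum F).
have : #|Hsub lam mu|%:R *: phi f = 0.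
  rewrite -phiZ fE phi_sum big1 // => g gW; rewrite phi_sum big1 // => T _.
  by rewrite [LHS]phiZ none ?scaler0 ?WnV.
move/eqP; rewrite scaler_eq0 (negbTE H0) /= => /eqP e.
by rewrite e eqxx in phif.
Qed.

End Induced.

(** * Column antisymmetry and the bounds on the numbers of parts *)

Section Antisymmetry.
Variables (k : fieldType) (lam mu : seq nat).
Local Notation a := (sumn lam).
Local Notation b := (sumn mu).
Local Notation n := (a + b)%N.
Local Notation pos := (pos_pt n).

Lemma swapB_pos_Wn i j : (i < n)%N -> (j < n)%N -> swapB (pos i) (pos j) \in Wn n.
Proof. by move=> hi hj; rewrite swapB_Wn ?pos_neq_rev. Qed.

Lemma tabl_perm_invg1 l (t : tabl l) : tabl_perm t (1^-1)%g = t.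
Proof. by apply/ffunP => x; rewrite ffunE invg1 perm1. Qed.

Lemma block_perm_swapA (x y : 'I_a) :
  @block_perm lam mu (swapB (pos x) (pos y)) (tperm x y) 1%g.
Proof.
split=> [|z|z]; first by apply: swapB_pos_Wn; exact: ltA.
  rewrite swapB_pos ?ltA //.
  have -> : (if z == x :> nat then y : nat else if z == y :> nat then x : nat else z) = tperm x y z.
    case: tpermP => [->|->|/eqP zx /eqP zy]; rewrite ?eqxx //.
      by case: eqP => // ->.
    by rewrite !val_eqE (negbTE zx) (negbTE zy).
  by rewrite abs_pt_pos ?ltA.
rewrite swapB_pos ?ltA ?ltB // perm1.
by rewrite !gtn_eqF ?abs_pt_pos ?ltB //; apply: leq_trans (leq_addr _ _).
Qed.

Lemma block_perm_swapB (x y : 'I_b) :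
  @block_perm lam mu (swapB (pos (a + x)) (pos (a + y))) 1%g (tperm x y).
Proof.
split=> [|z|z]; first by apply: swapB_pos_Wn; exact: ltB.
  rewrite swapB_pos ?ltA ?ltB // perm1.
  by rewrite !ltn_eqF ?abs_pt_pos ?ltA //; apply: leq_trans (leq_addr _ _).
rewrite swapB_pos ?ltB // !eqn_add2l.
have -> : (if z == x :> nat then a + y else if z == y :> nat then a + x else a + z)%N
    = (a + tperm x y z)%N.
  case: tpermP => [->|->|/eqP zx /eqP zy]; rewrite ?eqxx //.
    by case: eqP => // ->.
  by rewrite !val_eqE (negbTE zx) (negbTE zy).
by rewrite abs_pt_pos ?ltB.
Qed.

Lemma block_perm_flip i : (i < n)%N -> @block_perm lam mu (flipB (pos i)) 1%g 1%g.
Proof.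
move=> hi; split=> [|z|z]; first exact: flipB_Wn.
  rewrite flipB_pos ?ltA // perm1; case: eqP => [->|_]; rewrite ?abs_pt_rev abs_pt_pos ?ltA //.
rewrite flipB_pos ?ltB // perm1; case: eqP => [->|_]; rewrite ?abs_pt_rev abs_pt_pos ?ltB //.
Qed.

Lemma sgnB_swapA (x y : 'I_a) : @sgnB k lam mu (swapB (pos x) (pos y)) = 1.
Proof.
rewrite sgnB_prod big1 // => z _; rewrite swapB_pos ?ltA ?ltB //.
rewrite !gtn_eqF ?val_pos ?ltB //; first by rewrite ltnNge leq_addr.
all: by apply: leq_trans (leq_addr _ _).
Qed.

Lemma sgnB_swapB (x y : 'I_b) : @sgnB k lam mu (swapB (pos (a + x)) (pos (a + y))) = 1.
Proof.
rewrite sgnB_prod big1 // => z _; rewrite swapB_pos ?ltB //.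
by case: ifP => _; [|case: ifP => _]; rewrite val_pos ?ltB // ltnNge leq_addr.
Qed.

Lemma sgnB_flipA (x : 'I_a) : @sgnB k lam mu (flipB (pos x)) = 1.
Proof.
rewrite sgnB_prod big1 // => z _; rewrite flipB_pos ?ltA ?ltB //.
rewrite gtn_eqF ?val_pos ?ltB //; first by rewrite ltnNge leq_addr.
by apply: leq_trans (leq_addr _ _).
Qed.

Lemma sgnB_flipB (x : 'I_b) : @sgnB k lam mu (flipB (pos (a + x))) = -1.
Proof.
rewrite sgnB_prod (bigD1 x) //= big1 ?mulr1 => [|z zx].
  rewrite flipB_pos ?ltB // eqxx /= val_pos ?ltB //.
  by rewrite (_ : (_ < n)%N = true) ?expr1 //; have := ltn_ord x; lia.
rewrite flipB_pos ?ltB // eqn_add2l val_eqE (negbTE zx) val_pos ?ltB //.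
by rewrite ltnNge leq_addr.
Qed.

Lemma HomV_nonzero_bound (d : nat) (N : FSBmod k) :
  [pchar k] =i pred0 -> dsmallish d N -> is_partition lam -> is_partition mu ->
  HomV_nonzero lam mu N -> (size lam <= d.+1)%N /\ (size mu <= d)%N.
Proof.
move=> char0 dN lamP muP [phi [philin [f fV phif] equiv]].
have [g [T [gW phig]]] := generator_spans char0 philin fV phif.
have act t : t \in Wn n -> phi (Defs.gactV t (generator k T)) = perm_act t (phi (generator k T)).
  move=> tW; apply: equiv => //; first exact: generator_inV.
  by move=> x; rewrite hom_permE.
pose x := phi (generator k T).
have x0 : x != 0.
  apply: contraNneq phig => x0; rewrite act // -/x x0.
  by have [G GE] := exists_lfun (@perm_act_is_linear n k N g); rewrite -GE linear0.
have actx t pA pB eps : @block_perm lam mu t pA pB ->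
    (forall q, @sgnB k lam mu t * polytab2 k T (tabl_perm q.1 pA^-1%g, tabl_perm q.2 pB^-1%g)
       = eps * polytab2 k T q) -> perm_act t x = eps *: x.
  move=> tb te; have [tW _ _] := tb.
  rewrite /x -act // (gactV_generator tb te).
  by have [G GE] := exists_lfun philin; rewrite -!GE linearZ.
split.
  (* The positions are the first-column letters of [T.1]; flips act trivially on this block, hence
     [eps] is false. *)
  have := @antisym_positions_bound k d n (size lam) N x (fun i => T.1 (col_cell lamP i)) false.
  rewrite addn0; apply=> //.
  - by move=> i j /val_inj/perm_inj/col_cell_inj.
  - by move=> i; exact: ltA.
  - move=> i j ij; rewrite -scaleN1r; apply: (actx _ _ _ _ (block_perm_swapA _ _)) => q.
    rewrite sgnB_swapA mul1r /polytab2 /= tabl_perm_invg1 tpermV polytab_antisym ?mulN1r ?mulNr //.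
      by rewrite (inj_eq (@col_cell_inj _ _)).
    by rewrite !col0_cell.
  - move=> i; rewrite expr0; apply: (actx _ _ _ _ (block_perm_flip (ltA _ _))) => q.
    by rewrite sgnB_flipA !tabl_perm_invg1; case: q.
(* On the second block flips act by -1, so [eps] is true and the bound improves by one. *)
have := @antisym_positions_bound k d n (size mu) N x (fun i => a + T.2 (col_cell muP i))%N true.
rewrite addn1 ltnS; apply=> //.
- by move=> i j /addnI/val_inj/perm_inj/col_cell_inj.
- by move=> i; exact: ltB.
- move=> i j ij; rewrite -scaleN1r; apply: (actx _ _ _ _ (block_perm_swapB _ _)) => q.
  rewrite sgnB_swapB mul1r /polytab2 /= tabl_perm_invg1 tpermV polytab_antisym ?mulN1r ?mulrN //.
    by rewrite (inj_eq (@col_cell_inj _ _)).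
  by rewrite !col0_cell.
- move=> i; rewrite expr1; apply: (actx _ _ _ _ (block_perm_flip (ltB _ _))) => q.
  by rewrite sgnB_flipB !tabl_perm_invg1; case: q.
Qed.

End Antisymmetry.

(** * Rationality, growth and length bounds combined *)

Local Open Scope classical_set_scope.
Local Open Scope ring_scope.

Theorem mainTheorem2 (k : fieldType) (R : realType) (d : nat) (N : FSBmod k) :
  [pchar k] =i pred0 ->
  dsmallish d N ->
  (* (1) H_B(N;t) = P(t) / prod_{j=1}^{2d+1} (1 - j t)^(e_j) *)
  (exists (P : {poly rat}) (e : nat -> nat),
     forall n : nat,
       \sum_(i < n.+1)
          (\prod_(1 <= j < (2 * d + 2)%N) (1 - j%:R *: 'X) ^+ e j)`_i
            * (dimB N (n - i))%:R = P`_n)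
  /\
  (* (2) lim_n dim N[-n,n] / (2d+1)^n exists *)
  (exists l : R,
     (fun n : nat => (dimB N n)%:R / ((2 * d + 1) ^ n)%:R : R) @ \oo --> l)
  /\
  (* (3) *)
  (forall lam mu : seq nat,
     is_partition lam -> is_partition mu ->
     HomV_nonzero lam mu N ->
     (size lam <= d.+1)%N /\ (size mu <= d)%N).
Proof.
move=> char0 dN; have [rat_dim cvg_dim] := dsmallish_tame R dN.
(* The upper limit [2 * d + 2] is the successor of the parameter [2 * d + 1] of [den]. *)
split; first by rewrite addnS.
by split=> // lam mu; exact: HomV_nonzero_bound.
Qed.
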